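(* Let $\{N_0;J\}$ be the nilpotent orbit of weight $k$ whose underlying mixed Hodge structure is of Hodge–Tate type, with real bigrading $V=\bigoplus_{p=0}^kJ^{p,p}$, $\dim J^{p,p}=n$ for $0\le p\le k$, polarized by $N_0$, so that $N_0$ gives a chain $$J^{k,k}\xrightarrow{N_0}J^{k-1,k-1}\xrightarrow{N_0}\cdots\xrightarrow{N_0}J^{1,1}\xrightarrow{N_0}J^{0,0}$$ of isomorphisms. Then the maximal dimension of any infinitesimal variation of Hodge structure at infinity (IVI) $(\{N_0;J\},\mathfrak{a})$ is $$\begin{cases}\tfrac12\alpha(\alpha+1)+\beta+1 & \text{for } n=2\alpha+\beta>1 \text{ with } \beta\in\{0,1\},\\ 1 & \text{for } n=1.\end{cases}$$ Furthermore, up to conjugation, there is only one maximal dimension IVI $(\{N_0;J\},\mathfrak{a})$ for $n$ even and there are two for $n$ odd.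
   Context: Setting. $V_{\mathbb{R}}$ is a finite-dimensional real vector space, $V=\mathbb{C}\otimes V_{\mathbb{R}}$, and $Q$ is a nondegenerate bilinear form on $V$ defined over $\mathbb{R}$ with $Q(u,v)=(-1)^kQ(v,u)$. $G_{\mathbb{C}}=O(V,Q)$ is the group of isometries of $Q$, with Lie algebra $\mathfrak{g}_{\mathbb{C}}$; $\mathfrak{g}_{\mathbb{R}}$ is the Lie algebra of the subgroup preserving $V_{\mathbb{R}}$. The nilpotent orbit $\{N_0;J\}$. $V=\bigoplus_{p=0}^kJ^{p,p}$, where each $J^{p,p}$ is defined over $\mathbb{R}$ ($\overline{J^{p,p}}=J^{p,p}$) and has dimension $n$, and $Q(J^{p,p},J^{p',p'})=0$ unless $p+p'=k$. $N_0\in\mathfrak{g}_{\mathbb{R}}$ is nilpotent, maps $J^{p,p}$ isomorphically onto $J^{p-1,p-1}$ for $1\le p\le k$, and kills $J^{0,0}$. With $F^p=\bigoplus_{a\ge p}J^{a,a}$ and $W_l=\bigoplus_{2a\le l}J^{a,a}$, the data $(W_*,F^*,N_0,Q)$ form a polarized mixed Hodge structure of weight $k$; in this case polarization means that the symmetric form $Q_k(\cdot,\cdot)=Q(\cdot,N_0^k\cdot)$ is positive definite on the real form of $J^{k,k}$. Then $\{N_0;F^*\}$ is a nilpotent orbit (denoted $\{N_0;J\}$), i.e. $\exp(zN_0)\cdot F^*$ is a $Q$-polarized Hodge structure of weight $k$ for $\mathrm{Im}(z)$ large; all its Hodge numbers $h^{a,k-a}$, $0\le a\le k$, equal $n$.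 IVI. Let $\mathfrak{p}_{-1}=\{X\in\mathfrak{g}_{\mathbb{C}}:X(J^{p,p})\subset J^{p-1,p-1}\ \forall p\}$ (with $J^{-1,-1}=0$). An infinitesimal variation of Hodge structure at infinity (IVI) with nilpotent orbit $\{N_0;J\}$ is a pair $(\{N_0;J\},\mathfrak{a})$ with $\mathfrak{a}\subset\mathfrak{p}_{-1}$ an abelian complex subspace (any two elements commute) containing $N_0$. Its dimension is $\dim_{\mathbb{C}}\mathfrak{a}$. Conjugation. Two IVIs $(\{N_0;J\},\mathfrak{a})$ and $(\{N_0;J\},\mathfrak{a}')$ are conjugate if $\mathfrak{a}'=g\mathfrak{a}g^{-1}$ for some $g\in G_{\mathbb{C}}$ that preserves every $J^{p,p}$ and commutes with $N_0$; by restriction to $J^{k,k}$ the group of such $g$ is identified with the complex orthogonal group $O(J^{k,k},Q_k)\cong O(n,\mathbb{C})$.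
   Formalization: Proved for k ≥ 1, and k ≥ 2 when n > 1 (for k = 1, n > 1 all of p_{-1} is abelian, of dimension n(n+1)/2; for k = 0 the dimension is 0). The count of one or two maximal IVIs up to conjugation is stated only for n ≥ 6, since it fails for every n ≤ 5. *)

(* Defs.v *)
From HB Require Import structures.
From mathcomp Require Import all_boot all_order all_algebra.
From mathcomp Require Import sesquilinear complex.
From mathcomp Require Import reals.

Set Implicit Arguments.
Unset Strict Implicit.
Unset Printing Implicit Defensive.

Import Order.TTheory GRing.Theory Num.Theory.
Local Open Scope ring_scope.
Local Open Scope complex_scope.

(* C (x) V_R, modelled as V_R x V_R: the pair (x, y) is 1 (x) x + i (x) y. *)
Definition complexification (R : realType) (VR : vectType R) : Type :=
  (VR * VR)%type.

Section Complexification.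
Variables (R : realType) (VR : vectType R).
Local Notation V := (complexification VR).

HB.instance Definition _ := GRing.Zmodule.copy V (VR * VR)%type.

Definition cplx_scale (z : R[i]) (u : V) : V :=
  let: (x, y) := u in (complex.Re z *: x - complex.Im z *: y, complex.Re z *: y + complex.Im z *: x).

Fact cplx_scaleA a b u :
  cplx_scale a (cplx_scale b u) = cplx_scale (a * b) u.
Proof.
case: a b u => [a1 a2] [b1 b2] [x y]; rewrite /cplx_scale /=.
rewrite !scalerBr !scalerDr !scalerBl !scalerDl !scalerA !opprD.
by congr pair; rewrite [LHS](AC (2*2) ((1*4)*(2*3))).
Qed.

Fact cplx_scale1 : left_id 1 cplx_scale.
Proof.
by case=> x y; rewrite /cplx_scale /= !scale1r !scale0r subr0 addr0.
Qed.

Fact cplx_scaleDr : right_distributive cplx_scale +%R.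
Proof.
case=> a b [x y] [x' y']; rewrite /cplx_scale /=; congr pair => /=.
  by rewrite !scalerDr opprD addrACA.
by rewrite !scalerDr addrACA.
Qed.

Fact cplx_scaleDl u : {morph cplx_scale^~ u : a b / a + b}.
Proof.
case: u => x y [a b] [a' b']; rewrite /cplx_scale /=; congr pair => /=.
  by rewrite !scalerDl opprD addrACA.
by rewrite !scalerDl addrACA.
Qed.

HB.instance Definition _ := GRing.Zmodule_isLmodule.Build R[i] V
  cplx_scaleA cplx_scale1 cplx_scaleDr cplx_scaleDl.

Import VectorInternalTheory.

Fact cplx_vect_axiom : Vector.axiom (dim VR) V.
Proof.
exists (fun u : V => \row_j (v2r u.1 0 j +i* v2r u.2 0 j)).
  move=> [a b] [x y] [x' y']; apply/rowP=> j; rewrite !mxE /=.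
  rewrite !linearD !linearN !linearZ /= !mxE.
  by rewrite mulrN; simpc.
exists (fun w : 'rV[R[i]]_(dim VR) =>
                 (r2v (\row_j complex.Re (w 0 j)),
                  r2v (\row_j complex.Im (w 0 j))) : V).
  case=> x y /=; congr pair; apply: (can_inj v2rK); rewrite r2vK;
    by apply/rowP=> j; rewrite !mxE.
by move=> w; apply/rowP=> j; rewrite mxE /= !r2vK !mxE; case: (w 0 j).
Qed.

HB.instance Definition _ := Lmodule_hasFinDim.Build R[i] V cplx_vect_axiom.

Definition of_real (x : VR) : V := (x, 0).

Definition cconj (u : V) : V := (u.1, - u.2).

End Complexification.

Section InfinitesimalVariations.
Variables (R : realType) (VR : vectType R).
Local Notation V := (complexification VR).

Record polarization_form (k : nat) (Q : {biscalar V}) : Prop := {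
  form_parity : forall u v, Q u v = (-1) ^+ k * Q v u;
  form_nondegenerate : forall u, (forall v, Q u v = 0) -> u = 0;
  form_real : forall x y : VR, exists r : R, Q (of_real x) (of_real y) = r%:C
}.

Definition isometry_group (Q : {biscalar V}) (g : 'End(V)) : Prop :=
  lker g = 0%VS /\ forall u v, Q (g u) (g v) = Q u v.

Definition lie_algebra (Q : {biscalar V}) (X : 'End(V)) : Prop :=
  forall u v, Q (X u) v + Q u (X v) = 0.

Definition real_lie_algebra (Q : {biscalar V}) (X : 'End(V)) : Prop :=
  lie_algebra Q X /\ forall x : VR, exists y : VR, X (of_real x) = of_real y.

(* J p stands for J^{p,p}; its values at p > k are irrelevant.
   The remaining requirements on a polarized mixed Hodge structure, for
   F^p = (+)_{a >= p} J^{a,a} and W_l = (+)_{2a <= l} J^{a,a}, follow from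
   the fields below: the chain of isomorphisms makes W the monodromy weight
   filtration of N0 centered at k, and the only nonzero primitive part is that
   of Gr^W_{2k} = J^{k,k}, whose polarization is orbit_positive. *)
Record hodge_tate_orbit (k n : nat) (Q : {biscalar V})
    (J : nat -> {vspace V}) (N0 : 'End(V)) : Prop := {
  orbit_form : polarization_form k Q;
  orbit_span : (\sum_(p < k.+1) J p)%VS = fullv;
  orbit_direct : directv (\sum_(p < k.+1) J p)%VS;
  orbit_real : forall p, (p <= k)%N -> forall u, u \in J p -> cconj u \in J p;
  orbit_dim : forall p, (p <= k)%N -> \dim (J p) = n;
  orbit_orthogonal : forall p q, (p <= k)%N -> (q <= k)%N -> (p + q)%N <> k ->
    forall u v, u \in J p -> v \in J q -> Q u v = 0;
  orbit_lie : real_lie_algebra Q N0;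
  orbit_nilpotent : exists m, forall u, iter m N0 u = 0;
  orbit_onto : forall p, (p < k)%N -> (N0 @: J p.+1)%VS = J p;
  orbit_into : forall p, (p < k)%N -> (lker N0 :&: J p.+1)%VS = 0%VS;
  orbit_kill : (N0 @: J 0%N)%VS = 0%VS;
  orbit_positive : forall x : VR, x != 0 -> of_real x \in J k ->
    0 < Q (of_real x) (iter k N0 (of_real x))
}.

(* The space p_{-1}. *)
Definition horizontal (k : nat) (Q : {biscalar V}) (J : nat -> {vspace V})
    (X : 'End(V)) : Prop :=
  [/\ lie_algebra Q X,
      forall p, (p < k)%N -> (X @: J p.+1 <= J p)%VS
    & (X @: J 0%N)%VS = 0%VS].

Definition is_IVI (k : nat) (Q : {biscalar V}) (J : nat -> {vspace V})
    (N0 : 'End(V)) (a : {vspace 'End(V)}) : Prop :=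
  [/\ forall X, X \in a -> horizontal k Q J X,
      forall X Y, X \in a -> Y \in a -> (X \o Y)%VF = (Y \o X)%VF
    & N0 \in a].

Definition max_dim_IVI (k : nat) (Q : {biscalar V}) (J : nat -> {vspace V})
    (N0 : 'End(V)) (a : {vspace 'End(V)}) : Prop :=
  is_IVI k Q J N0 a /\ forall b, is_IVI k Q J N0 b -> (\dim b <= \dim a)%N.

(* Classifying the IVIs of maximal dimension up to this relation has low-rank
   exceptions: for k >= 2 an IVI is a commuting space of complex symmetric
   n x n matrices containing 1%:M, and for n <= 5 the maximal dimension is n,
   attained by the diagonal matrices as well as, for 2 <= n, by algebras with
   a nonzero nilradical.  For k = 1 commutation is vacuous. *)
Definition conjugate_IVI (k : nat) (Q : {biscalar V}) (J : nat -> {vspace V})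
    (N0 : 'End(V)) (a a' : {vspace 'End(V)}) : Prop :=
  exists g : 'End(V),
    [/\ isometry_group Q g,
        forall p, (p <= k)%N -> (g @: J p)%VS = J p,
        (g \o N0)%VF = (N0 \o g)%VF
      & forall Y, Y \in a' <->
          exists2 X, X \in a & Y = (g \o X \o g^-1)%VF].

End InfinitesimalVariations.

(* Main.v *)
Require Import Defs.
From HB Require Import structures.
From mathcomp Require Import all_boot all_order all_algebra.
From mathcomp Require Import sesquilinear complex.
From mathcomp Require Import reals spectral zify.

(** An IVI contains N0, so its elements commute with N0 and each is determined
    by the operator it induces on J^{k,k} (after identifying J^{k-1,k-1} with
    J^{k,k} through N0).  In a Q_k-orthonormal basis these operators form a
    commuting space b of complex symmetric n x n matrices containing 1, and
    conjugacy becomes conjugation by O(n, C).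

    Bound on dim b: take a common eigenvector v.  If v.v <> 0, split off v.
    If v is isotropic, let m be the subspace of b killing v; it acts on
    v^perp / v, and the kernel of m -> End(v^perp / v) consists of operators
    x |-> (v.x) w + (w.x) v + c (v.x) v whose w is killed by m modulo v.  Hence
    one bounds, by simultaneous induction, dim b and dim b + dim (kernel of b).

    Following the case of equality for n >= 6 through the induction gives an
    isotropic subspace L of dimension n/2 (rounded down) on which b acts by
    scalars.  The elements of b killing L are then Sym^2 L, together with one
    more operator when n is odd, which is either the projection onto a vector
    e of L^perp with e.e = 1 or the symmetric product of e with a nonzero
    vector of L.  Witt's theorem for (L, e) gives the classification, and the
    two odd cases differ because only the first contains a nontrivial
    projection. *)

Set Implicit Arguments.
Unset Strict Implicit.
Unset Printing Implicit Defensive.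

Import GRing.Theory Num.Theory.

(** * Complex symmetric forms *)

Section SymmetricForms.
Local Open Scope ring_scope.
Variable F : numClosedFieldType.

(** Polarization: if the form vanished on every sum of two basis vectors, the case [i = j] would
    kill the diagonal of [G], and the other cases would then kill the remaining entries. *)
Lemma sym_form_neq0 n (G : 'M[F]_n) :
  G^T = G -> G != 0 -> exists x : 'rV_n, x *m G *m x^T != 0.
Proof.
move=> symG Gn0; pose x i j : 'rV[F]_n := delta_mx 0 i + delta_mx 0 j.
case: (pickP (fun ij => x ij.1 ij.2 *m G *m (x ij.1 ij.2)^T != 0)) =>
  [[i j]|G0].
  by exists (x i j).
case/eqP: Gn0; have {}G0 i j : G i i + G i j + (G j i + G j j) = 0.
  have /negbFE/eqP/matrixP/(_ 0 0) := G0 (i, j).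
  rewrite /x linearD /= !(mulmxDl, mulmxDr) -!rowE !trmx_delta -!colE !mxE.
  by move=> <-.
have Gii i : G i i = 0.
  have := G0 i i; rewrite -!mulr2n -mulrnA => /eqP.
  by rewrite mulrn_eq0 => /eqP.
apply/matrixP=> i j; have := G0 i j.
have -> : G j i = G i j by rewrite -[in RHS]symG mxE.
by rewrite !Gii add0r addr0 -mulr2n mxE => /eqP; rewrite mulrn_eq0 => /eqP.
Qed.

Lemma normalize_form n (G : 'M[F]_n) (x : 'rV_n) :
  x *m G *m x^T != 0 ->
  exists2 c, c != 0 & (c *: x) *m G *m (c *: x)^T = 1%:M.
Proof.
rewrite [_ *m x^T]mx11_scalar; set d := (_ *m _) 0 0 => d0.
have {}d0 : d != 0 by apply: contraNneq d0 => ->; rewrite raddf0.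
exists (sqrtC d)^-1; first by rewrite invr_eq0 sqrtC_eq0.
rewrite linearZ /= -!scalemxAl -scalemxAr [x *m _ *m _]mx11_scalar -/d.
rewrite scalerA -invfM -expr2 sqrtCK scale_scalar_mx mulVf //.
Qed.

(** Diagonalization, one square at a time: for [y] with [y G y^T = 1], subtracting the square of the
    linear form [y G] adds [y] to the kernel, so the rank drops. *)
Lemma sym_factor n r (G : 'M[F]_n) :
  G^T = G -> (\rank G <= r)%N -> exists C : 'M_(r, n), G = C^T *m C.
Proof.
elim: r G => [|r IH] G symG rkG.
  exists 0; rewrite mulmx0; apply/eqP.
  by rewrite -mxrank_eq0 -leqn0.
have [->|Gn0] := eqVneq G 0; first by exists 0; rewrite mulmx0.
have [x xGx] := sym_form_neq0 symG Gn0.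
have [c c0] := normalize_form xGx; set y := c *: x => yGy.
pose G' := G - (y *m G)^T *m (y *m G).
have GyT : (y *m G)^T = G *m y^T by rewrite trmx_mul symG.
have symG' : G'^T = G' by rewrite /G' linearB /= trmx_mul trmxK symG.
have yG' : y *m G' = 0.
  by rewrite /G' mulmxBr GyT !mulmxA yGy mul1mx subrr.
have [|C CE] := IH G' symG'.
  have : (kermx G < kermx G')%MS.
    rewrite ltmxE; apply/andP; split.
      apply/sub_kermxP; rewrite /G' mulmxBr mulmx_ker GyT !mulmxA mulmx_ker.
      by rewrite !mul0mx subr0.
    apply: contraTN isT => kerG; have : (y <= kermx G)%MS.
      by apply: submx_trans kerG; apply/sub_kermxP.
    move/sub_kermxP=> yG0; move: yGy; rewrite yG0 mul0mx => /matrixP/(_ 0 0).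
    by rewrite !mxE => /eqP; rewrite eq_sym oner_eq0.
  move/rank_ltmx; rewrite !mxrank_ker => lt_rk; move: rkG.
  have := rank_leq_row G; lia.
exists (col_mx (y *m G) C).
by rewrite (@tr_col_mx _ 1 r) (@mul_row_col _ _ 1 r) -CE addrC subrK.
Qed.

(** [Z'] is the dual basis of [Z] inside the same subspace, so [1 - Z^T Z'] is the orthogonal
    projection onto the complement. Being symmetric of rank [m] it factors as [C^T C], and
    idempotence makes the rows of [C] orthonormal. *)
Lemma orth_compl n r m (Z Z' : 'M[F]_(r, n)) :
    n = (r + m)%N -> Z' *m Z^T = 1%:M -> (Z^T *m Z')^T = Z^T *m Z' ->
  exists C : 'M_(m, n), [/\ C^T *m C = 1%:M - Z^T *m Z', C *m C^T = 1%:M,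
    C *m Z^T = 0 & C *m Z'^T = 0].
Proof.
move=> def_n ZZ symZ; pose P := 1%:M - Z^T *m Z'.
have symP : P^T = P by rewrite /P linearB /= symZ trmx1.
have PZ : P *m Z^T = 0 by rewrite mulmxBl mul1mx -mulmxA ZZ mulmx1 subrr.
have ZZ' : Z *m Z'^T = 1%:M by rewrite -[Z]trmxK -trmx_mul ZZ trmx1.
have PZ' : P *m Z'^T = 0.
  by rewrite /P -symZ trmx_mul trmxK mulmxBl mul1mx -mulmxA ZZ' mulmx1 subrr.
have PP : P *m P = P by rewrite {2}/P mulmxBr mulmx1 mulmxA PZ mul0mx subr0.
have rkZ : \rank Z^T = r.
  rewrite mxrank_tr; apply/eqP/row_freeP; exists Z'^T.
  by rewrite -[Z]trmxK -trmx_mul ZZ trmx1.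
have rkP : (\rank P = m)%N.
  have := mulmx0_rank_max PZ.
  have : (\rank (P + Z^T *m Z')%R <= \rank P + r)%N.
    apply: leq_trans (mxrank_add _ _) _.
    by rewrite leq_add2l -[X in (_ <= X)%N]rkZ mxrankM_maxl.
  rewrite subrK mxrank1; lia.
have [|C PE] := @sym_factor n m P symP; first by rewrite rkP.
have /row_freeP[D CD] : row_free C.
  rewrite /row_free eqn_leq rank_leq_row /= -[X in (X <= _)%N]rkP PE.
  exact: mxrankM_maxr.
have DC : D^T *m C^T = 1%:M by rewrite -trmx_mul CD trmx1.
have CC : C *m C^T = 1%:M.
  have /(congr1 (fun X => D^T *m X *m D)) := PP.
  by rewrite PE !mulmxA DC mul1mx -!mulmxA CD mulmx1.
have CP : C = C *m P by rewrite PE mulmxA CC mul1mx.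
by exists C; rewrite -PE CC CP -!mulmxA PZ PZ' !mulmx0.
Qed.

(** A right inverse of [L] gives a dual family; it is made orthogonal to [E], and then isotropic by
    subtracting half of its Gram matrix times [L]. *)
Lemma isotropic_dual n a r (L : 'M[F]_(a, n)) (E : 'M_(r, n)) :
    row_free L -> L *m L^T = 0 -> E *m E^T = 1%:M -> L *m E^T = 0 ->
  exists M : 'M_(a, n), [/\ L *m M^T = 1%:M, M *m M^T = 0 & M *m E^T = 0].
Proof.
case/row_freeP=> D LD LL EE LE; pose M1 := D^T - D^T *m E^T *m E.
have ME1 : M1 *m E^T = 0 by rewrite mulmxBl
  -[_ *m E *m _]mulmxA EE mulmx1 subrr.
have LM1 : L *m M1^T = 1%:M.
  rewrite /M1 linearB /= !trmx_mul !trmxK mulmxBr LD !mulmxA LE.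
  by rewrite !mul0mx subr0.
have ML1 : M1 *m L^T = 1%:M by rewrite -[M1]trmxK -trmx_mul LM1 trmx1.
have EL : E *m L^T = 0 by rewrite -[E]trmxK -trmx_mul LE trmx0.
clearbody M1; have [S SE] : exists S, S = M1 *m M1^T by eexists.
have symS : S^T = S by rewrite SE trmx_mul trmxK.
have MT : (M1 - 2^-1 *: (S *m L))^T = M1^T - 2^-1 *: (L^T *m S).
  by rewrite linearB linearZ /= trmx_mul symS.
exists (M1 - 2^-1 *: (S *m L)); rewrite MT; split.
- by rewrite mulmxBr LM1 -scalemxAr mulmxA LL mul0mx scaler0 subr0.
- rewrite !(mulmxBl, mulmxBr) -!scalemxAl -!scalemxAr !mulmxA ML1 mul1mx.
  rewrite -[S *m L *m _]mulmxA LM1 mulmx1 -[S *m L *m _]mulmxA LL.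
  rewrite mulmx0 mul0mx !scaler0 subr0 -addrA -opprD -scalerDl.
  rewrite -[2^-1]mul1r -mulrDl -mulr2n divff ?pnatr_eq0 //.
  by rewrite scale1r SE subrr.
- by rewrite mulmxBl ME1 -scalemxAl -mulmxA LE mulmx0 scaler0 subrr.
Qed.

Lemma isotropic_frame n a b (L : 'M[F]_(a, n)) :
    n = (a + a + b)%N -> row_free L -> L *m L^T = 0 ->
  exists M : 'M_(a, n), exists E : 'M_(b, n),
    [/\ [/\ L *m M^T = 1%:M, M *m M^T = 0 & M *m E^T = 0],
        [/\ E *m E^T = 1%:M, L *m E^T = 0 & E *m L^T = 0]
      & L^T *m M + M^T *m L + E^T *m E = 1%:M].
Proof.
move=> def_n freeL LL.
have [||M [LM MM _]] := @isotropic_dual n a 0 L 0 freeL LL.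
- by apply/matrixP=> [[]].
- by apply/matrixP=> i [].
have ML : M *m L^T = 1%:M by rewrite -[M]trmxK -trmx_mul LM trmx1.
(* [(L, M)] and [(M, L)] are dual bases of the hyperbolic space spanned by [L] and [M]; [E] is an
   orthonormal basis of its complement. *)
have [|||E [EE E1 EL EM]] := @orth_compl n (a + a) b (col_mx L M) (col_mx M L).
- exact: def_n.
- by rewrite tr_col_mx mul_col_row MM ML LM LL -scalar_mx_block.
- by rewrite tr_col_mx mul_row_col linearD /= !trmx_mul !trmxK addrC.
move: EE EL EM; rewrite !tr_col_mx mul_row_col !mul_mx_row => EE.
rewrite -row_mx0 => /eq_row_mx[EL EM] _.
have LE : L *m E^T = 0 by rewrite -[L]trmxK -trmx_mul EL trmx0.
have ME : M *m E^T = 0 by rewrite -[M]trmxK -trmx_mul EM trmx0.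
by exists M, E; rewrite EE addrC subrK.
Qed.

End SymmetricForms.

(** * Upper bound for commuting symmetric matrices *)

Section MaximalDimension.

(** The binomial is the dimension of Sym^2 of an isotropic space of dimension [n./2], [odd n] counts
    the extra operator and [1] the scalars. For [n <= 1] this sum would be too large by one. *)
Definition maxdim n := if n <= 1 then n else 'C(n./2.+1, 2) + odd n + 1.

Lemma maxdim_even a : 0 < a -> maxdim a.*2 = 'C(a.+1, 2) + 1.
Proof.
by case: a => // a _; rewrite /maxdim doubleS /= odd_double doubleK addn0.
Qed.

Lemma maxdim_odd a : 0 < a -> maxdim a.*2.+1 = 'C(a.+1, 2) + 2.
Proof.
case: a => // a _; rewrite /maxdim doubleS /= odd_double uphalf_double.
by rewrite -addnA.
Qed.

Lemma bin2S a : 'C(a.+2, 2) = 'C(a.+1, 2) + a.+1.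
Proof. by rewrite binS bin1. Qed.

Lemma evenVodd n : {a | n = a.*2} + {a | n = a.*2.+1}.
Proof.
have := odd_double_half n.
by case: (odd n) => <-; [right | left]; exists n./2.
Qed.

Lemma maxdimS n : maxdim n + 1 <= maxdim n.+1.
Proof.
case: (evenVodd n) => [] [[|a] ->] //.
  by rewrite maxdim_even // maxdim_odd //; lia.
by rewrite maxdim_odd // -doubleS maxdim_even // (bin2S a.+1); lia.
Qed.

Lemma maxdimSS n : 1 < n -> maxdim n.+2 = maxdim n + n./2 + 1.
Proof.
case: (evenVodd n) => [] [[|a] ->] // _.
  rewrite -doubleS !maxdim_even // (bin2S a.+1); lia.
rewrite -doubleS !maxdim_odd // (bin2S a.+1); lia.
Qed.

End MaximalDimension.

(** * Commuting spaces of symmetric matrices *)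

Section CommutingSymmetric.
Local Open Scope ring_scope.
Variable F : numClosedFieldType.

Definition commsym n (b : {vspace 'M[F]_n}) : Prop :=
  (forall A, A \in b -> A^T = A) /\
  (forall A B, A \in b -> B \in b -> A *m B = B *m A).

(** Used in three ways: restriction to the span of orthonormal rows [C], conjugation by an
    orthogonal matrix ([C = g^T]), and embedding of small symmetric matrices ([C = L^T]). *)
Definition compress m n (C : 'M[F]_(m, n)) : 'Hom('M[F]_n, 'M[F]_m) :=
  linfun (mulmxr C^T \o mulmx C).

Lemma compressE m n (C : 'M[F]_(m, n)) A : compress C A = C *m A *m C^T.
Proof. by rewrite lfunE. Qed.

Lemma commsymS n (b b' : {vspace 'M[F]_n}) :
  (b <= b')%VS -> commsym b' -> commsym b.
Proof.
move=> /subvP sub [sym com]; split=> [A /sub|A B /sub Ab /sub];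
  first exact: sym.
exact: com.
Qed.

(** The hypothesis allows inserting [C^T *m C] between two elements of [b], which makes the
    compression multiplicative on [b]. *)
Lemma commsym_compress m n (C : 'M[F]_(m, n)) b :
    commsym b ->
    (forall A B, A \in b -> B \in b ->
      C *m A *m (C^T *m C) *m B *m C^T = C *m A *m B *m C^T) ->
  commsym (compress C @: b).
Proof.
move=> [sym com] CC; split=> [_ /memv_imgP[A Ab ->]|].
  by rewrite compressE !trmx_mul trmxK sym // mulmxA.
move=> _ _ /memv_imgP[A Ab ->] /memv_imgP[B Bb ->]; rewrite !compressE.
have E X Y : X \in b -> Y \in b ->
    C *m X *m C^T *m (C *m Y *m C^T) = C *m (X *m Y) *m C^T.
  by move=> Xb Yb; rewrite !mulmxA -CC // !mulmxA.
by rewrite !E // com.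
Qed.

Lemma commsym_add1 n (b : {vspace 'M[F]_n}) :
  commsym b -> commsym (b + <[1%:M]>)%VS.
Proof.
move=> [sym com]; split=> [_ /memv_addP[A Ab [_ /vlineP[c ->] ->]]|].
  by rewrite linearD linearZ /= trmx1 sym.
move=> _ B' /memv_addP[A Ab [_ /vlineP[c ->] ->]].
case/memv_addP=> B Bb [_ /vlineP[d ->] ->].
rewrite !(mulmxDl, mulmxDr) com // !scalemx1 !mul_scalar_mx !mul_mx_scalar.
by rewrite -!addrA; congr (_ + _); rewrite addrCA !scale_scalar_mx mulrC.
Qed.

Lemma row_free_mul p m n (L : 'M[F]_(p, m)) (C : 'M_(m, n)) :
  C *m C^T = 1%:M -> row_free L -> row_free (L *m C).
Proof.
move=> CC; rewrite /row_free mxrankMfree //.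
by apply/row_freeP; exists C^T.
Qed.

Lemma dim_img_ker (V W : vectType F) (f : 'Hom(V, W)) (U K : {vspace V}) :
    (forall u, u \in U -> f u = 0 -> u \in K) ->
  (\dim U <= \dim (f @: U) + \dim K)%N.
Proof.
move=> kerf; rewrite -(limg_ker_dim f U) addnC leq_add2l; apply: dimvS.
by apply/subvP=> u; rewrite memv_cap memv_ker => /andP[/kerf uK /eqP].
Qed.

Lemma dim_le1 (V : vectType F) (U : {vspace V}) (v : V) :
  (forall u, u \in U -> exists c, u = c *: v) -> (\dim U <= 1)%N.
Proof.
move=> line; apply: leq_trans (_ : \dim <[v]>%VS <= 1)%N; last first.
  by rewrite dim_vline leq_b1.
by apply/dimvS/subvP=> u /line[c ->]; rewrite memvZ ?memv_line.
Qed.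

Lemma commsym_eigenvector n (b : {vspace 'M[F]_n}) :
    (0 < n)%N -> commsym b ->
  exists2 v : 'rV_n, v != 0 & forall A, A \in b -> exists c, v *m A = c *: v.
Proof.
move=> n_gt0 [_ com]; have [|v v0 /allP stab] :=
    @common_eigenvector F n (vbasis b) n_gt0.
  by move=> A B /vbasis_mem Ab /vbasis_mem Bb; apply: com.
exists v => // A Ab; apply/sub_rVP; rewrite (coord_vbasis Ab) mulmx_sumr.
apply: summx_sub => i _; rewrite -scalemxAr scalemx_sub // stab //.
by rewrite mem_nth // size_tuple.
Qed.

Lemma vspace_mx n (K : {vspace 'rV[F]_n}) :
  exists2 M : 'M_(\dim K, n), row_free M & forall x, (x \in K) = (x <= M)%MS.
Proof.
pose M := \matrix_(i < \dim K) (vbasis K)`_i.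
have ME y : y *m M = \sum_i y 0 i *: (vbasis K)`_i.
  by rewrite mulmx_sum_row; apply: eq_bigr => i _; rewrite rowK.
exists M => [|x].
  apply: inj_row_free => y; rewrite ME => y0.
  move/freeP: (basis_free (vbasisP K)) => /(_ _ y0) y00.
  by apply/rowP=> i; rewrite mxE y00.
apply/idP/submxP=> [xK|[y ->]].
  exists (\row_i coord (vbasis K) i x); rewrite ME {1}(coord_vbasis xK).
  by apply: eq_bigr => i _; rewrite mxE.
rewrite ME rpred_sum // => i _; rewrite rpredZ // vbasis_mem //.
by rewrite mem_nth // size_tuple.
Qed.

End CommutingSymmetric.

(** * Splitting off a non-isotropic eigenvector *)

Section UnitReduction.
Local Open Scope ring_scope.
Variables (F : numClosedFieldType) (n : nat) (e : 'rV[F]_n.+1).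
Hypothesis ee : e *m e^T = 1%:M.

Lemma unit_frame : exists C : 'M[F]_(n, n.+1),
  [/\ C^T *m C = 1%:M - e^T *m e, C *m C^T = 1%:M & C *m e^T = 0].
Proof.
have [|C [CC C1 Ce _]] := @orth_compl F n.+1 1 n e e (erefl _) ee;
  last by exists C.
by rewrite trmx_mul trmxK.
Qed.

Variable C : 'M[F]_(n, n.+1).
Hypothesis CC : C^T *m C = 1%:M - e^T *m e.
Hypothesis Ce : C *m e^T = 0.

Lemma sym_eigen A c : A^T = A -> e *m A = c *: e -> A *m e^T = c *: e^T.
Proof. by move=> symA eA; rewrite -[A]symA -trmx_mul eA linearZ. Qed.

(** By symmetry a left eigenvector is also a right one, so [A] preserves both the line of [e] and
    its orthogonal complement. *)
Lemma unit_decomp A c : A^T = A -> e *m A = c *: e ->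
  A = c *: (e^T *m e) + C^T *m compress C A *m C.
Proof.
move=> symA eA; have Ae := sym_eigen symA eA.
rewrite compressE !mulmxA CC -!mulmxA CC mulmxBl mul1mx mulmxBr.
rewrite !mulmxBr mulmx1 !mulmxA Ae -[e^T *m e *m A]mulmxA eA -!scalemxAr
  -!scalemxAl.
rewrite -[e^T *m e *m _]mulmxA ee mulmx1 subrr subr0.
by rewrite addrC subrK.
Qed.

Lemma commsym_unit (b : {vspace 'M[F]_n.+1}) :
    commsym b -> (forall A, A \in b -> exists c, e *m A = c *: e) ->
  commsym (compress C @: b).
Proof.
move=> symb eb; apply: (commsym_compress symb) => A B Ab Bb.
have [c eA] := eb _ Ab; rewrite CC mulmxBr mulmx1 mulmxBl.
rewrite -[C *m A *m (e^T *m e)]mulmxA [A *m _]mulmxA.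
rewrite (sym_eigen _ eA) ?(proj1 symb) // -!scalemxAl
  -scalemxAr [C *m (_ *m _)]mulmxA.
by rewrite Ce mul0mx scaler0 mul0mx subr0.
Qed.

Lemma dim_unit (b : {vspace 'M[F]_n.+1}) :
    commsym b -> (forall A, A \in b -> exists c, e *m A = c *: e) ->
  (\dim b <= \dim (compress C @: b) + 1)%N.
Proof.
move=> [sym _] eb; apply: leq_trans (dim_img_ker (f := compress C) (K :=
  <[e^T *m e]>%VS) _) _.
  move=> A Ab CA; have [c eA] := eb _ Ab.
  rewrite (unit_decomp (sym _ Ab) eA) CA mulmx0 mul0mx addr0.
  by rewrite memvZ ?memv_line.
by rewrite leq_add2l dim_vline leq_b1.
Qed.

Lemma dim_unit0 (b : {vspace 'M[F]_n.+1}) :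
    commsym b -> (forall A, A \in b -> e *m A = 0) ->
  (\dim b <= \dim (compress C @: b))%N.
Proof.
move=> [sym _] eb; have := @dim_img_ker _ _ _ (compress C) b 0%VS.
rewrite dimv0 addn0; apply=> A Ab CA.
rewrite (@unit_decomp A 0) ?sym // ?eb ?scale0r //.
by rewrite CA mulmx0 mul0mx addr0 mem0v.
Qed.

End UnitReduction.

(** * Operators killing an isotropic vector *)

Section IsotropicReduction.
Local Open Scope ring_scope.
Variables (F : numClosedFieldType) (n : nat) (v w : 'rV[F]_n.+2).
Variable C : 'M[F]_(n, n.+2).
Hypothesis res : v^T *m w + w^T *m v + C^T *m C = 1%:M.
Variable m : {vspace 'M[F]_n.+2}.
Hypothesis commm : commsym m.
Hypothesis vm : forall A, A \in m -> v *m A = 0.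

Lemma isotropic_killedr A : A \in m -> A *m v^T = 0.
Proof.
by move=> Am; rewrite -[A](proj1 commm) // -trmx_mul vm // trmx0.
Qed.

(** Of the other terms of [res], [v^T *m w] is killed by [A] from the left and [w^T *m v] by [B]
    from the right. *)
Lemma mul_mid A B : A \in m -> B \in m -> A *m (C^T *m C) *m B = A *m B.
Proof.
move=> Am Bm.
have -> : C^T *m C = 1%:M - v^T *m w - w^T *m v.
  by apply/esym/eqP; rewrite !subr_eq -res [X in X == _](AC 3 (3*2*1)).
rewrite !mulmxBr mulmx1 !mulmxBl mulmxA isotropic_killedr // !mul0mx subr0.
by rewrite -!mulmxA vm // !mulmx0 subr0.
Qed.

Lemma commsym_isotropic : commsym (compress C @: m).
Proof.
apply: (commsym_compress commm) => A B Am Bm.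
by rewrite -[C *m A *m _]mulmxA -[C *m _ *m B]mulmxA mul_mid // mulmxA.
Qed.

(* An A killing v is determined by its compression to the row space of C, by
   wcoord A, and by a multiple of v^T *m v. *)
Definition wcoord : 'Hom('M[F]_n.+2, 'rV[F]_n) :=
  linfun (mulmxr C^T \o mulmx w).

Lemma wcoordE A : wcoord A = w *m A *m C^T.
Proof. by rewrite lfunE. Qed.

(** By [mul_mid], the two sides are [w] times the product of [A] and [B] in the two orders. *)
Lemma wcoordC A B : A \in m -> B \in m ->
  wcoord B *m compress C A = wcoord A *m compress C B.
Proof.
move=> Am Bm; rewrite !wcoordE !compressE.
have E X Y : X \in m -> Y \in m ->
    w *m X *m C^T *m (C *m Y *m C^T) = w *m (X *m Y) *m C^T.
  by move=> Xm Ym; rewrite -[in RHS]mul_mid // !mulmxA.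
by rewrite !E // (proj2 commm).
Qed.

Lemma isotropic_decomp A : A \in m -> compress C A = 0 -> wcoord A = 0 ->
  A \in <[v^T *m v]>%VS.
Proof.
rewrite compressE wcoordE => Am CA wA.
have CAw : C *m A *m w^T = 0.
  by rewrite -[C]trmxK -[A](proj1 commm) // -!trmx_mul mulmxA wA trmx0.
have expand p (X : 'M_(p, n.+2)) :
    X *m A = X *m A *m w^T *m v + X *m A *m C^T *m C.
  rewrite -[LHS]mulmx1 -res !mulmxDr !mulmxA
    -[X *m A *m v^T]mulmxA isotropic_killedr //.
  by rewrite mulmx0 mul0mx add0r.
rewrite -[A]mul1mx -res !mulmxDl -!mulmxA vm // mulmx0 addr0.
rewrite (expand _ w) (expand _ C) CA CAw wA !mul0mx !addr0 mulmx0 addr0.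
rewrite [_ *m w^T]mx11_scalar mul_scalar_mx -scalemxAr.
by rewrite memvZ ?memv_line.
Qed.

(** The rows of [K] are a basis of the [wcoord] values of the elements with zero compression;
    [wcoordC] then says that every compression is killed by [K]. The final [1] accounts for the
    multiples of [v^T *m v]. *)
Lemma isotropic_kernel : exists p (K : 'M[F]_(p, n)),
  (forall A, A \in m -> K *m compress C A = 0) /\
  (\dim m <= \dim (compress C @: m) + \rank K + 1)%N.
Proof.
pose k := (m :&: lker (compress C))%VS.
have [K freeK inK] := vspace_mx (wcoord @: k).
exists _, K; split=> [A Am|].
  apply/row_matrixP=> i; rewrite row_mul row0.
  have : row i K \in (wcoord @: k)%VS by rewrite inK row_sub.
  case/memv_imgP=> B; rewrite memv_cap memv_ker => /andP[Bm /eqP CB] ->.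
  by rewrite wcoordC // CB mulmx0.
rewrite (eqP freeK) -(limg_ker_dim (compress C) m) -/k addnC -addnA leq_add2l.
apply: leq_trans (dim_img_ker (f := wcoord) (K := <[v^T *m v]>%VS) _) _.
  move=> A; rewrite memv_cap memv_ker => /andP[Am /eqP CA].
  exact: isotropic_decomp.
by rewrite leq_add2l dim_vline leq_b1.
Qed.

End IsotropicReduction.

(** * Simultaneous induction on the size of the matrices *)

Section UpperBound.
Local Open Scope ring_scope.
Variable F : numClosedFieldType.

Lemma dim_add_line (V : vectType F) (U : {vspace V}) v :
  v \notin U -> \dim (U + <[v]>) = (\dim U).+1.
Proof.
move=> vU; rewrite dimv_disjoint_sum ?dim_vline.
  by case: eqP vU => [->|_ _]; rewrite ?mem0v ?addn1.
apply/eqP; rewrite -subv0; apply/subvP=> u; rewrite memv_cap.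
case/andP=> uU /vlineP[c uE]; rewrite memv0 uE scaler_eq0.
apply: contraNT vU; rewrite negb_or => /andP[c0 _].
by rewrite -[v]scale1r -(mulVf c0) -scalerA -uE memvZ.
Qed.

Lemma isotropic_rank p n (K : 'M[F]_(p, n)) :
  K *m K^T = 0 -> ((\rank K).*2 <= n)%N.
Proof. by move/mulmx0_rank_max; rewrite mxrank_tr addnn. Qed.

Lemma isotropicVunit p n (K : 'M[F]_(p, n)) : K *m K^T = 0 \/
  exists y : 'rV_p, y *m K *m (y *m K)^T = 1%:M.
Proof.
have symK : (K *m K^T)^T = K *m K^T by rewrite trmx_mul trmxK.
have [->|] := eqVneq (K *m K^T) 0; first by left.
case/(sym_form_neq0 symK)=> x /normalize_form[c _ ex]; right.
by exists (c *: x); rewrite -ex trmx_mul !mulmxA.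
Qed.

Lemma isotropicVunit1 n (v : 'rV[F]_n) :
  v *m v^T = 0 \/ exists2 c, c != 0 & c *: v *m (c *: v)^T = 1%:M.
Proof.
have [->|] := eqVneq (v *m v^T) 0; first by left.
have := @normalize_form _ _ 1%:M v; rewrite mulmx1 => /[apply] -[c c0].
by rewrite mulmx1; right; exists c.
Qed.

Lemma dim_killed_add1 p n (b : {vspace 'M[F]_n}) (K : 'M[F]_(p, n)) :
    K != 0 -> (forall A, A \in b -> K *m A = 0) ->
  \dim (b + <[1%:M]>) = (\dim b).+1.
Proof.
move=> K0 Kb; apply: dim_add_line.
by apply: contra K0 => /Kb; rewrite mulmx1 => ->.
Qed.

(** The unit vector [e] in the span of [K] is killed by [b], so splitting it off loses nothing from
    [b] and at most one from the rank of [K]. *)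
Lemma kernel_unit p n (b : {vspace 'M[F]_n.+1}) (K : 'M[F]_(p,
  n.+1)) (y : 'rV_p)
    (C : 'M_(n, n.+1)) :
    let e := y *m K in
    e *m e^T = 1%:M -> C^T *m C = 1%:M - e^T *m e -> C *m e^T = 0 ->
    commsym b -> (forall A, A \in b -> K *m A = 0) ->
  [/\ commsym (compress C @: b),
      forall A, A \in (compress C @: b)%VS -> K *m C^T *m A = 0,
      (\dim b <= \dim (compress C @: b))%N &
      (\rank K <= \rank (K *m C^T) + 1)%N].
Proof.
move=> e ee CC Ce symb Kb.
have eb A : A \in b -> e *m A = 0 by move=> /Kb KA; rewrite -mulmxA KA mulmx0.
clearbody e; split.
- by apply: (commsym_unit CC Ce symb) => A /eb ->; exists 0; rewrite scale0r.
- move=> _ /memv_imgP[A Ab ->]; rewrite compressE !mulmxA -[K *m _ *m C]mulmxA.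
  rewrite CC mulmxBr mulmx1 !mulmxBl Kb // mul0mx sub0r [K *m _]mulmxA.
  by rewrite -[_ *m e *m A]mulmxA eb // mulmx0 mul0mx oppr0.
- exact: (dim_unit0 ee CC symb eb).
- rewrite -[K in leqLHS]mulmx1 -(subrK (e^T *m e) 1%:M) -CC mulmxDr !mulmxA.
  apply: leq_trans (mxrank_add _ _) (leq_add (mxrankM_maxl _ _) _).
  by apply: leq_trans (mxrankM_maxr _ _) (rank_leq_row _).
Qed.

(** A non-isotropic eigenvector costs one dimension and lowers the size by one. An isotropic one
    lowers the size by two and costs its eigenvalue, the multiples of [v^T *m v] and [\rank K],
    whence the shape of the second bound. *)
Lemma commsym_dim_step n :
    (forall m, (m < n)%N ->
      (forall b : {vspace 'M[F]_m}, commsym b -> (\dim b <= maxdim m)%N) /\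
      (forall (b : {vspace 'M[F]_m}) p (K : 'M_(p, m)), commsym b ->
        (forall A, A \in b -> K *m A = 0) ->
        (\dim b + \rank K + 2 <= maxdim m.+2)%N)) ->
  forall b : {vspace 'M[F]_n}, commsym b -> (\dim b <= maxdim n)%N.
Proof.
case: n => [|n] IH b symb.
  by apply: leq_trans (dimvS (subvf _)) _; rewrite dimvf dim_matrix.
have [//|v v0 vb] := commsym_eigenvector _ symb.
have [vv|[c c0 ee]] := isotropicVunit1 v; last first.
  have eb A : A \in b -> exists d, (c *: v) *m A = d *: (c *: v).
    move=> /vb[d vA]; exists d; by rewrite -scalemxAl vA !scalerA mulrC.
  have [C [CC _ Ce]] := unit_frame ee.
  have := dim_unit ee CC symb eb; have := maxdimS n.
  have [/(_ _ (commsym_unit CC Ce symb eb)) + _] := IH n (leqnn _).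
  rewrite -(leq_add2r 1) => dim1 dim2 dim3.
  exact: leq_trans dim3 (leq_trans dim1 dim2).
case: n => [|n] in b symb v v0 vb vv IH *.
  case/eqP: v0; apply/rowP=> i; move/matrixP/(_ 0 0): vv.
  rewrite !mxE big_ord1 !mxE !ord1 => /eqP.
  by rewrite mulf_eq0 orbb => /eqP.
have free_v : row_free v by rewrite /row_free rank_rV v0.
have [w [C [[vw _ _] [_ _ Cv] res]]] :=
  @isotropic_frame F n.+2 1 n v (erefl _) free_v vv.
pose m := (b :&: lker (linfun (mulmx v)))%VS.
have vm A : A \in m -> v *m A = 0.
  by rewrite memv_cap memv_ker lfunE => /andP[_ /eqP].
have symm : commsym m by apply: commsymS symb; apply: capvSl.
have bm : (\dim b <= \dim m + 1)%N.
  rewrite -(limg_ker_dim (linfun (mulmx v)) b) leq_add2l.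
  apply: (@dim_le1 _ _ _ v) => _ /memv_imgP[A /vb[c vA] ->].
  by exists c; rewrite lfunE.
have [p [K [Km dimm]]] := isotropic_kernel res symm vm.
have [_ /(_ _ p K (commsym_isotropic res symm vm))] := IH n (leqnSn _).
have killK A : A \in (compress C @: m)%VS -> K *m A = 0.
  by case/memv_imgP=> B /Km KB ->.
move/(_ killK) => dimm'; apply: leq_trans bm (leq_trans _ dimm').
by rewrite -[2%N]/(1 + 1)%N addnA leq_add2r.
Qed.

(** If [K] is nonzero and isotropic, its rank is at most [n./2] and [1%:M] lies outside [b], so [b]
    is one short of its bound; [maxdimSS] is exactly the resulting sum. If the span of [K] contains
    a unit vector, that vector is split off. *)
Lemma kernel_dim_step n :
    (forall m, (m < n)%N ->
      (forall (b : {vspace 'M[F]_m}) p (K : 'M_(p, m)), commsym b ->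
        (forall A, A \in b -> K *m A = 0) ->
        (\dim b + \rank K + 2 <= maxdim m.+2)%N)) ->
    (forall b : {vspace 'M[F]_n}, commsym b -> (\dim b <= maxdim n)%N) ->
  forall (b : {vspace 'M[F]_n}) p (K : 'M_(p, n)), commsym b ->
    (forall A, A \in b -> K *m A = 0) ->
  (\dim b + \rank K + 2 <= maxdim n.+2)%N.
Proof.
move=> IH bound b p K symb Kb.
have [K0|Kn0] := eqVneq K 0.
  have := bound b symb; have := maxdimS n; have := maxdimS n.+1.
  rewrite K0 mxrank0; lia.
have [KK|[y ee]] := isotropicVunit K.
  have := isotropic_rank KK; have : (0 < \rank K)%N by rewrite lt0n mxrank_eq0.
  have := bound _ (commsym_add1 symb); rewrite (dim_killed_add1 Kn0 Kb).
  case: n => [|[|n]] in b p K symb Kb Kn0 KK IH bound *; try lia.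
  rewrite (@maxdimSS n.+2) //; lia.
case: n => [|n] in b p K symb Kb Kn0 y ee IH bound *.
  by case/eqP: Kn0; apply/matrixP=> i [].
have [C [CC _ Ce]] := unit_frame ee.
have [symb' Kb'] := kernel_unit ee CC Ce symb Kb.
move=> dimb rkK; have := IH n (leqnn _) _ _ _ symb' Kb'.
rewrite -(leq_add2r 1) => /leq_trans/(_ (maxdimS _)); apply: leq_trans.
by rewrite [leqRHS]addnAC leq_add2r -addnA leq_add.
Qed.

Theorem commsym_dim n (b : {vspace 'M[F]_n}) :
  commsym b -> (\dim b <= maxdim n)%N.
Proof.
suff: (forall b : {vspace 'M[F]_n}, commsym b -> (\dim b <= maxdim n)%N) /\
  (forall (b : {vspace 'M[F]_n}) p (K : 'M_(p, n)), commsym b ->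
    (forall A, A \in b -> K *m A = 0) ->
    (\dim b + \rank K + 2 <= maxdim n.+2)%N) by case=> H _; apply: H.
elim/ltn_ind: n {b} => n IH; have P := commsym_dim_step IH; split=> //.
by apply: kernel_dim_step => // m /IH[].
Qed.

Lemma kernel_dim n (b : {vspace 'M[F]_n}) p (K : 'M_(p, n)) : commsym b ->
    (forall A, A \in b -> K *m A = 0) ->
  (\dim b + \rank K + 2 <= maxdim n.+2)%N.
Proof.
elim/ltn_ind: n b p K => n IH; apply: kernel_dim_step => // b.
exact: commsym_dim.
Qed.

End UpperBound.

(** * Spaces of maximal dimension *)

Lemma maxdimE a r : 0 < a -> r <= 1 -> maxdim (a + a + r) = 'C(a.+1, 2) + r + 1.
Proof.
move=> a_gt0; rewrite addnn; case: r => [|[|//]] _.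
  by rewrite !addn0 maxdim_even.
by rewrite addn1 maxdim_odd // -addnA.
Qed.

(** * The symmetric square of an isotropic space *)

Section SymmetricSquare.
Local Open Scope ring_scope.
Variable F : numClosedFieldType.

Definition symmx a : {vspace 'M[F]_a} := lker (linfun (trmx \- idfun)).

Lemma mem_symmx a (S : 'M[F]_a) : (S \in symmx a) = (S^T == S).
Proof. by rewrite memv_ker lfunE /= subr_eq0. Qed.

(** Induction on the size: [f] deletes the first row and column, and [g] reads the first row, which
    determines a symmetric matrix whose remaining block is zero. *)
Lemma dim_symmx a : \dim (symmx a) = 'C(a.+1, 2).
Proof.
elim: a => [|a IH].
  by apply/eqP; rewrite
    -leqn0 (leq_trans (dimvS (subvf _))) // dimvf dim_matrix.
pose f := linfun (@rsubmx F a 1 a \o @dsubmx F 1 a (1 + a));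
  pose g := linfun (@usubmx F 1 a (1 + a)).
have fE S : f S = drsubmx S by rewrite lfunE.
have gE S : g S = usubmx S by rewrite lfunE.
rewrite bin2S -IH -[a.+1]/(1 + a)%N -(limg_ker_dim f (symmx (1 + a))).
rewrite addnC; congr (_ + _)%N.
  have <- : (f @: symmx (1 + a))%VS = symmx a by
    apply/vspaceP=> S; rewrite mem_symmx; apply/memv_imgP/eqP;
    [case=> T; rewrite mem_symmx fE => /eqP symT ->; rewrite trmx_drsub symT
    |move=> symS; exists (block_mx 0 0 0 S);
     rewrite ?fE ?block_mxKdr // mem_symmx tr_block_mx !trmx0 symS].
  by [].
rewrite -(@limg_dim_eq _ _ _ g).
  rewrite (_ : (g @: _)%VS = fullv).
    by rewrite dimvf dim_matrix; apply: mul1n.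
  apply/vspaceP=> x; rewrite memvf; apply/memv_imgP.
  have lx : (lsubmx x)^T = lsubmx x by apply/matrixP=> i j; rewrite mxE !ord1.
  exists (block_mx (lsubmx x) (rsubmx x) (rsubmx x)^T 0).
    by rewrite memv_cap mem_symmx memv_ker fE block_mxKdr tr_block_mx lx trmxK
               trmx0 !eqxx.
  by rewrite gE /block_mx col_mxKu hsubmxK.
apply/eqP; rewrite -subv0; apply/subvP=> S.
rewrite !memv_cap mem_symmx !memv_ker fE gE memv0 =>
  /andP[/andP[/eqP symS /eqP Sdr]].
rewrite -{1}[S]submxK /block_mx col_mxKu -row_mx0 => /eqP/eq_row_mx[Sul Sur].
have Sdl : dlsubmx S = 0 by rewrite -symS -trmx_ursub Sur trmx0.
by rewrite -[S]submxK Sul Sur Sdl Sdr block_mx0.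
Qed.

(* Sym^2 of the row space of L, as symmetric operators. *)
Definition symsq a n (L : 'M[F]_(a, n)) : {vspace 'M[F]_n} :=
  (compress L^T @: symmx a)%VS.

Lemma symsqP a n (L : 'M[F]_(a, n)) A :
  reflect (exists2 S, S^T = S & A = L^T *m S *m L) (A \in symsq L).
Proof.
apply: (iffP memv_imgP) => -[S].
  by rewrite mem_symmx compressE trmxK => /eqP symS ->; exists S.
by move=> symS ->; exists S; rewrite ?mem_symmx ?symS // compressE trmxK.
Qed.

Lemma dim_symsq_le a n (L : 'M[F]_(a, n)) : (\dim (symsq L) <= 'C(a.+1, 2))%N.
Proof.
by rewrite -dim_symmx -(limg_ker_dim (compress L^T) (symmx a)) leq_addl.
Qed.

Lemma dim_symsq a n (L : 'M[F]_(a, n)) :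
  row_free L -> \dim (symsq L) = 'C(a.+1, 2).
Proof.
case/row_freeP=> D LD; rewrite -dim_symmx; apply: limg_dim_eq.
apply/eqP; rewrite -subv0; apply/subvP=> S.
rewrite memv_cap memv_ker memv0 compressE trmxK => /andP[_ /eqP LSL].
move/(congr1 (fun X => D^T *m X *m D)): LSL.
rewrite !mulmxA -trmx_mul LD trmx1 mul1mx -mulmxA LD mulmx1.
by rewrite mulmx0 mul0mx => ->.
Qed.

(** The hypothesis is the vanishing of all 2 x 2 minors of each pair [y], [z]. *)
Lemma dim_parallel n (Y : {vspace 'rV[F]_n}) :
    (forall y z, y \in Y -> z \in Y -> y^T *m z = z^T *m y) ->
  (\dim Y <= 1)%N.
Proof.
move=> par; have [->|Y0] := eqVneq Y 0%VS; first by rewrite dimv0.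
have /rV0Pn[i yi] : vpick Y != 0 by rewrite vpick0.
set y := vpick Y in yi; apply: (@dim_le1 _ _ _ y) => z zY.
exists (z 0 i / y 0 i); apply/rowP=> j.
move/matrixP/(_ i j): (par y z (memv_pick Y) zY).
rewrite !mxE !big_ord1 !mxE => yz.
by rewrite mulrAC -yz [y 0 i * _]mulrC mulfK.
Qed.

End SymmetricSquare.

Lemma dim_parallel_le1 (F : numClosedFieldType) r n
    (Y : {vspace 'M[F]_(r, n)}) : r <= 1 ->
    (forall y z, y \in Y -> z \in Y -> (y^T *m z = z^T *m y)%R) ->
  \dim Y <= r.
Proof.
case: r Y => [|[|//]] Y _ par; last exact: dim_parallel.
by rewrite (leq_trans (dimvS (subvf _))) // dimvf dim_matrix.
Qed.

(** * Commuting operators that kill an isotropic space *)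

Section KilledByIsotropic.
Local Open Scope ring_scope.
Variables (F : numClosedFieldType) (n a r : nat).
Variables (L M : 'M[F]_(a, n)) (E : 'M[F]_(r, n)).
Hypothesis res : L^T *m M + M^T *m L + E^T *m E = 1%:M.

Lemma killed_right A : A^T = A -> L *m A = 0 -> A *m L^T = 0.
Proof. by move=> symA LA; rewrite -[A]symA -trmx_mul LA trmx0. Qed.

Lemma killed_expand A : A^T = A -> L *m A = 0 ->
  A = A *m M^T *m L + A *m E^T *m E.
Proof.
move=> symA LA; rewrite -{1}[A]mulmx1 -res !mulmxDr !mulmxA.
by rewrite killed_right // mul0mx add0r.
Qed.

(** Inserting [res] on both sides of [A] leaves only the components along [L], with coefficient
    matrix [M A M^T]. *)
Lemma killed_symsq A : A^T = A -> L *m A = 0 -> E *m A = 0 -> A \in symsq L.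
Proof.
move=> symA LA EA; apply/symsqP; exists (M *m A *m M^T).
  by rewrite !trmx_mul trmxK symA mulmxA.
have AE : A *m E^T = 0 by rewrite -[A]symA -trmx_mul EA trmx0.
have AE1 : A = A *m M^T *m L.
  by rewrite {1}(killed_expand symA LA) AE mul0mx addr0.
rewrite {1}AE1 -{1}symA {1}AE1 !trmx_mul trmxK symA.
by rewrite !mulmxA.
Qed.

(* For A and B commuting this makes the rows of E *m A and E *m B parallel. *)
Lemma killed_mul A (B : 'M_n) : A^T = A -> L *m A = 0 -> L *m B = 0 ->
  A *m B = A *m E^T *m (E *m B).
Proof.
move=> symA LA LB; rewrite {1}(killed_expand symA LA) mulmxDl.
by rewrite -[_ *m L *m B]mulmxA LB mulmx0 add0r !mulmxA.
Qed.

Variable b : {vspace 'M[F]_n}.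
Hypothesis symb : commsym b.
Hypothesis Lb : forall A, A \in b -> L *m A = 0.
Hypothesis r_le1 : (r <= 1)%N.

(** The kernel of [A |-> E *m A] on [b] lies in [symsq L], and by [killed_mul] its values are
    parallel, so they span at most [r] dimensions. *)
Lemma dim_killed : (\dim b <= \dim (b :&: symsq L) + r)%N.
Proof.
pose f : 'Hom('M[F]_n, 'M[F]_(r, n)) := linfun (mulmx E).
have kerf A : A \in b -> f A = 0 -> A \in (b :&: symsq L)%VS.
  rewrite lfunE memv_cap => Ab /(killed_symsq _ _) -> //; last exact: Lb.
    by rewrite Ab.
  exact: (proj1 symb).
rewrite addnC; apply: leq_trans (dim_img_ker kerf) _; rewrite leq_add2r.
apply: dim_parallel_le1 r_le1 _ => _ _ /memv_imgP[A Ab ->] /memv_imgP[B Bb ->].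
have E1 X : X \in b -> (E *m X)^T = X *m E^T.
  by move=> Xb; rewrite trmx_mul (proj1 symb).
rewrite !lfunE /= !E1 // -!killed_mul ?Lb ?(proj1 symb) //.
exact: (proj2 symb).
Qed.

(** Equality in [dim_killed] leaves no room for a proper intersection with [symsq L]. *)
Lemma symsq_sub : ('C(a.+1, 2) + r <= \dim b)%N -> (symsq L <= b)%VS.
Proof.
move=> dimb; suff /eqP <- : (b :&: symsq L == symsq L)%VS by apply: capvSl.
rewrite eqEdim capvSr -(leq_add2r r) (leq_trans _ dim_killed) //.
by rewrite (leq_trans _ dimb) // leq_add2r dim_symsq_le.
Qed.

End KilledByIsotropic.

(** * Equality in the bound involving the kernel *)

Section Extremal.
Local Open Scope ring_scope.
Variable F : numClosedFieldType.

(** Equality makes both estimates of the isotropic case sharp: [K] has rank [a], so its row space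
    provides [L], and [b] is large enough for [symsq_sub]. *)
Lemma extremal_kernel_isotropic a r m p (b : {vspace 'M[F]_m}) (K : 'M_(p, m)) :
    m = (a + a + r)%N -> (r <= 1)%N -> (1 < a)%N -> commsym b ->
    (forall A, A \in b -> K *m A = 0) -> K *m K^T = 0 ->
    (maxdim m.+2 <= \dim b + \rank K + 2)%N ->
  exists L : 'M_(a, m), [/\ row_free L, L *m L^T = 0, (L <= K)%MS &
    (symsq L <= b)%VS].
Proof.
move=> def_m r_le1 a_gt1 symb Kb KK max.
have halfm : m./2 = a by rewrite def_m; lia.
have maxm : maxdim m = ('C(a.+1, 2) + r + 1)%N by rewrite def_m maxdimE // ltnW.
have maxS := @maxdimSS m; rewrite halfm in maxS.
have rkK := isotropic_rank KK.
have Kn0 : K != 0.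
  apply: contraTneq max => ->; rewrite mxrank0.
  have := commsym_dim symb; lia.
have := commsym_dim (commsym_add1 symb);
  rewrite (dim_killed_add1 Kn0 Kb) => dimb.
have rk : \rank K = a by lia.
have dimb' : ('C(a.+1, 2) + r <= \dim b)%N by lia.
have [D KD] : exists D, row_base K = D *m K.
  by apply/submxP; rewrite eq_row_base.
have freeL := row_base_free K; have subL : (row_base K <= K)%MS.
  by rewrite eq_row_base.
have LL : row_base K *m (row_base K)^T = 0.
  by rewrite KD trmx_mul -mulmxA [K *m _]mulmxA KK mul0mx mulmx0.
have Lb A : A \in b -> row_base K *m A = 0.
  by move=> Ab; rewrite KD -mulmxA Kb ?mulmx0.
move: (row_base K) freeL subL LL Lb; rewrite rk => L freeL subL LL Lb.
exists L; split=> //; have [M [E [_ _ res]]] := isotropic_frame def_m freeL LL.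
exact: (symsq_sub res symb Lb r_le1 dimb').
Qed.

(** A unit vector in the span of [K] can occur only in odd size. Splitting it off preserves equality
    and leads to even size; the operators found there lift back because [b] kills [e]. *)
Lemma extremal_kernel a r m p (b : {vspace 'M[F]_m}) (K : 'M_(p, m)) :
    (1 < a)%N -> m = (a + a + r)%N -> (r <= 1)%N -> commsym b ->
    (forall A, A \in b -> K *m A = 0) ->
    (maxdim m.+2 <= \dim b + \rank K + 2)%N ->
  exists L : 'M_(a, m), [/\ row_free L, L *m L^T = 0, (L <= K)%MS &
    (symsq L <= b)%VS].
Proof.
move=> a_gt1; elim/ltn_ind: m r p b K => m IH r p b K def_m r_le1 symb Kb max.
have [KK|[y ee]] := isotropicVunit K.
  exact: (extremal_kernel_isotropic def_m).
case: m => [|m] in IH b K def_m symb Kb max y ee *; first lia.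
have [C [CC C1 Ce]] := unit_frame ee.
have [symb' Kb' dimb rkK] := kernel_unit ee CC Ce symb Kb.
have bound' := kernel_dim symb' Kb'.
have max' : (maxdim m.+3 <= \dim (compress C @: b) + \rank (K *m C^T) + 2 +
  1)%N.
  by rewrite (leq_trans max) // [leqRHS]addnAC leq_add2r -addnA leq_add.
(* From size [2a + 1] to [2a + 2] the bound jumps by [a > 1], while splitting off [e] loses at most
   one; this excludes [r = 0]. *)
have def_m' : m = (a + a + 0)%N.
  case: r => [|[|//]] in def_m r_le1 *; last lia.
  have := leq_trans max' (_ : _ <= maxdim m.+2 + 1)%N.
  rewrite leq_add2r => /(_ bound').
  have -> : m.+3 = (a.+1 + a.+1 + 0)%N by lia.
  have -> : m.+2 = (a + a + 1)%N by lia.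
  rewrite !maxdimE //; last lia.
  rewrite bin2S; lia.
have maxm : (maxdim m.+2 <= \dim (compress C @: b) + \rank (K *m C^T) + 2)%N.
  by rewrite -(leq_add2r 1) (leq_trans (maxdimS _)).
have [L [freeL LL subL Lb]] :=
  IH m (leqnn _) 0%N p _ (K *m C^T) def_m' isT symb' Kb' maxm.
have CLT : L *m C *m C^T = L by rewrite -mulmxA C1 mulmx1.
exists (L *m C); split.
- exact: row_free_mul.
- by rewrite trmx_mul mulmxA CLT LL.
- apply: submx_trans (submxMr C subL) _; rewrite -mulmxA CC mulmxBr mulmx1.
  by rewrite mulmxA addmx_sub // eqmx_opp mulmxA submxMl.
- apply/subvP=> _ /symsqP[S symS ->].
  have : L^T *m S *m L \in symsq L by apply/symsqP; exists S.
  move/(subvP Lb)/memv_imgP=> [B Bb SE].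
  have := unit_decomp (c := 0%R) ee CC (proj1 symb _ Bb).
  rewrite -mulmxA Kb // mulmx0 scale0r => /(_ (erefl _)).
  by rewrite scale0r add0r -SE trmx_mul !mulmxA => <-.
Qed.

End Extremal.

(** * Lifting the isotropic space past an isotropic eigenvector *)

Section ScalarAction.
Local Open Scope ring_scope.
Variable F : numClosedFieldType.

(** Test on [S = E_ii] and [T = E_ij + E_ji] with [j != i]: entry [j] of [f S T] is [f_i], that of
    [f T S] is 0. *)
Lemma row_comm_sym0 a (f : 'rV[F]_a) : (1 < a)%N ->
    (forall S T : 'M_a, S^T = S -> T^T = T -> f *m S *m T = f *m T *m S) ->
  f = 0.
Proof.
move=> a_gt1 fC; apply/rowP=> i; rewrite mxE.
have [j ij] : exists j : 'I_a, i != j.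
  case: a a_gt1 f fC i => [|[|a]] // _ _ _ i.
  have [->|] := eqVneq i ord0; first by exists ord_max.
  by exists ord0.
have := fC (delta_mx i i) (delta_mx i j + delta_mx j i).
rewrite linearD /= !trmx_delta addrC => /(_ (erefl _) (erefl _)).
rewrite -!mulmxA mulmxDl mulmxDr !mul_delta_mx_cond eqxx (negPf ij) eq_sym.
rewrite (negPf ij) !mulr0n !mulr1n add0r addr0 => /rowP/(_ j).
rewrite !mxE (bigD1 i) //= big1 => [|k ki];
  last by rewrite mxE (negPf ki) mulr0.
rewrite big1 => [|k _]; first by rewrite mxE !eqxx mulr1 addr0.
by rewrite mxE [j == i]eq_sym (negPf ij) andbF mulr0.
Qed.

Lemma row_dual a (f : 'rV[F]_a) : f != 0 -> exists z : 'rV_a, f *m z^T = 1%:M.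
Proof.
case/rV0Pn=> i fi; exists ((f 0 i)^-1 *: delta_mx 0 i).
rewrite linearZ /= trmx_delta -scalemxAr -colE.
by apply/matrixP=> j k; rewrite !ord1 !mxE mulVf.
Qed.

Section Isotropic.
Variables (n a : nat) (v w : 'rV[F]_n.+2) (C : 'M[F]_(n, n.+2)).
Hypothesis res : v^T *m w + w^T *m v + C^T *m C = 1%:M.
Variable m : {vspace 'M[F]_n.+2}.
Hypothesis symm : commsym m.
Hypothesis vm : forall A, A \in m -> v *m A = 0.
Variable L : 'M[F]_(a, n).
Hypothesis freeL : row_free L.
Hypothesis LL : L *m L^T = 0.
Hypothesis Lm : forall A, A \in m -> L *m compress C A = 0.
Hypothesis symsqm : (symsq L <= compress C @: m)%VS.
Hypothesis a_gt1 : (1 < a)%N.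
Hypothesis n_le : (n <= a + a + 1)%N.

(** Up to transposition this is [L C A w^T], the only obstruction to [A] killing the lift [L *m C]
    of [L]. *)
Local Notation f A := (wcoord w C A *m L^T).

Lemma symsq_lift S : S^T = S ->
  exists2 B, B \in m & compress C B = L^T *m S *m L.
Proof.
move=> symS; have : L^T *m S *m L \in symsq L by apply/symsqP; exists S.
by case/(subvP symsqm)/memv_imgP=> B Bm ->; exists B.
Qed.

Lemma wcoord_lift A B S : A \in m -> B \in m -> compress C B = L^T *m S *m L ->
  f A *m S *m L = wcoord w C B *m compress C A.
Proof.
by move=> Am Bm BS; rewrite (wcoordC res symm vm) // BS !mulmxA.
Qed.

(* Writing f S for the common value f B, one gets f S = f 1 *m S, hence
   f 1 *m S *m T = f 1 *m T *m S for all symmetric S and T. *)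
Lemma wcoord_lift0 B S : S^T = S -> B \in m -> compress C B = L^T *m S *m L ->
  f B = 0.
Proof.
have inj := @row_free_inj _ _ _ _ _ freeL.
have [B1 B1m] := symsq_lift (@trmx1 F a); rewrite mulmx1 => B1E.
have fE T X : X \in m -> compress C X = L^T *m T *m L -> f X = f B1 *m T.
  move=> Xm XT; apply: (inj 1); rewrite (wcoord_lift B1m Xm XT) B1E.
  by rewrite !mulmxA.
suff f0 : f B1 = 0 by move=> _ Bm /fE ->; rewrite ?f0 ?mul0mx.
apply: row_comm_sym0 => // {}S T symS symT.
have [X Xm XS] := symsq_lift symS; have [Y Ym YT] := symsq_lift symT.
rewrite -(fE S X) // -(fE T Y) //; apply: (inj 1).
by rewrite (wcoord_lift Xm Ym YT) XS !mulmxA.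
Qed.

(* If f A were nonzero, every row of L would be f A *m S *m L for a symmetric
   S, hence in the image under A of L^perp; but A kills L, which has codimension
   at most 1 in L^perp, so this image has rank at most 1. *)
Lemma wcoord_killed A : A \in m -> f A = 0.
Proof.
move=> Am; apply/eqP/negPn/negP=> /row_dual[z fz].
have subL : (L <= kermx L^T *m compress C A)%MS.
  apply/rV_subP=> _ /submxP[y ->]; pose c := (f A *m y^T) 0 0.
  have fy : f A *m y^T = c%:M by rewrite [LHS]mx11_scalar.
  (* A symmetric matrix carrying [f A] to [y]: the last term cancels the contribution [c *: z] of
     the second. *)
  pose S := z^T *m y + y^T *m z - c *: (z^T *m z).
  have symS : S^T = S.
    rewrite /S linearB linearD linearZ /= !trmx_mul !trmxK.
    by congr (_ - _); rewrite addrC.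
  have fS : f A *m S = y.
    rewrite mulmxBr mulmxDr -scalemxAr !mulmxA fz fy !mul1mx mul_scalar_mx.
    by rewrite addrK.
  have [B Bm BS] := symsq_lift symS.
  rewrite -fS (wcoord_lift Am Bm BS) submxMr //; apply/sub_kermxP.
  exact: wcoord_lift0 BS.
have := mxrank_mul_ker (kermx L^T) (compress C A).
rewrite mxrank_ker mxrank_tr (eqP freeL).
have := mxrankS subL; rewrite (eqP freeL).
have : (L <= kermx L^T :&: kermx (compress C A))%MS.
  rewrite sub_capmx; apply/andP; split; apply/sub_kermxP; last exact: Lm.
  exact: LL.
move/mxrankS; rewrite (eqP freeL); lia.
Qed.

End Isotropic.
End ScalarAction.

(** * Equality in the dimension bound: scalar action on an isotropic space *)

Section ExtremalScalar.
Local Open Scope ring_scope.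
Variable F : numClosedFieldType.

Lemma maximal_has1 n (b : {vspace 'M[F]_n}) :
  commsym b -> (maxdim n <= \dim b)%N -> 1%:M \in b.
Proof.
move=> symb max; apply/negPn/negP=> /dim_add_line dim1.
by have := commsym_dim (commsym_add1 symb); rewrite dim1 leqNgt ltnS max.
Qed.

(** For an isotropic eigenvector [v], the new [L] is [v] with the lift of a space of dimension
    [a - 1] given by [extremal_kernel], which requires [a - 1 > 1]. For a non-isotropic one, [n] is
    odd and [L] comes from size [n - 1]. *)
Lemma extremal_scalar a r n (b : {vspace 'M[F]_n}) :
    (2 < a)%N -> n = (a + a + r)%N -> (r <= 1)%N -> commsym b ->
    (maxdim n <= \dim b)%N ->
  exists L : 'M_(a, n), [/\ row_free L, L *m L^T = 0 &
    forall A, A \in b -> exists c, L *m A = c *: L].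
Proof.
move=> a_gt2; elim/ltn_ind: n r b => n IH r b def_n r_le1 symb max.
have [|v v0 vb] := commsym_eigenvector _ symb; first lia.
have [vv|[c c0 ee]] := isotropicVunit1 v; last first.
  set e := c *: v in ee.
  have eb A : A \in b -> exists d, e *m A = d *: e.
    move=> /vb[d vA]; exists d; by rewrite -scalemxAl vA !scalerA mulrC.
  clearbody e.
  case: n => [|n] in IH b def_n symb max v e ee {v0 vb} eb *; first lia.
  have [C [CC C1 Ce]] := unit_frame ee.
  have symb' := commsym_unit CC Ce symb eb.
  have max' := leq_trans max (dim_unit ee CC symb eb).
  (* As in [extremal_kernel], the jump of the bound from odd to even size excludes [r = 0]. *)
  have def_n' : n = (a + a + 0)%N.
    case: r => [|[|//]] in def_n r_le1 *; last lia.
    have bound' := commsym_dim symb'.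
    have := leq_trans max' (_ : _ <= maxdim n + 1)%N.
    rewrite leq_add2r => /(_ bound').
    case: a => [//|a] in def_n a_gt2 {IH} *.
    have -> : n.+1 = (a.+1 + a.+1 + 0)%N by lia.
    have -> : n = (a + a + 1)%N by lia.
    rewrite !maxdimE //; last lia.
    rewrite bin2S; lia.
  have maxn : (maxdim n <= \dim (compress C @: b))%N.
    by rewrite -(leq_add2r 1) (leq_trans (maxdimS _)).
  have [L [freeL LL Lb]] := IH n (leqnn _) 0%N _ def_n' isT symb' maxn.
  have CLT : L *m C *m C^T = L by rewrite -mulmxA C1 mulmx1.
  exists (L *m C); split=> [||A Ab].
  - exact: row_free_mul.
  - by rewrite trmx_mul mulmxA CLT LL.
  - have [d eA] := eb A Ab.
    have [d' LA] := Lb _ (memv_img (compress C) Ab); exists d'.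
    rewrite (unit_decomp ee CC (proj1 symb _ Ab) eA) mulmxDr -scalemxAr.
    rewrite !mulmxA -[L *m C *m e^T]mulmxA Ce mulmx0 mul0mx scaler0 add0r.
    by rewrite CLT LA scalemxAl.
have free_v : row_free v by rewrite /row_free rank_rV v0.
case: n => [|[|n]] in IH b def_n symb max v v0 vb vv free_v *; [lia|lia|].
have [w [C [[vw ww wC] [C1 vC Cv] res]]] :=
  @isotropic_frame F n.+2 1 n v (erefl _) free_v vv.
pose m := (b :&: lker (linfun (mulmx v)))%VS.
have mE A : (A \in m) = (A \in b) && (v *m A == 0).
  by rewrite memv_cap memv_ker lfunE.
have vm A : A \in m -> v *m A = 0 by rewrite mE => /andP[_ /eqP].
have symm : commsym m by apply: commsymS symb; apply: capvSl.
have bm : (\dim b <= \dim m + 1)%N.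
  rewrite -(limg_ker_dim (linfun (mulmx v)) b) leq_add2l.
  apply: (@dim_le1 _ _ _ v) => _ /memv_imgP[A /vb[c vA] ->].
  by exists c; rewrite lfunE.
have [p [K [Km dimm]]] := isotropic_kernel res symm vm.
have symm' := commsym_isotropic res symm vm.
have killK A : A \in (compress C @: m)%VS -> K *m A = 0.
  by case/memv_imgP=> B /Km KB ->.
have max' : (maxdim n.+2 <= \dim (compress C @: m) + \rank K + 2)%N.
  apply: leq_trans max (leq_trans bm _).
  by rewrite -[2%N]/(1 + 1)%N addnA leq_add2r.
case: a => [//|a] in a_gt2 def_n IH *.
have def_n' : n = (a + a + r)%N by lia.
have [L [freeL LL subL symL]] :=
  extremal_kernel a_gt2 def_n' r_le1 symm' killK max'.
have Lm A : A \in m -> L *m compress C A = 0.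
  by move=> Am; have /submxP[D ->] := subL; rewrite -mulmxA Km // mulmx0.
have n_le : (n <= a + a + 1)%N by rewrite def_n' leq_add2l.
have wL A := wcoord_killed res symm vm freeL LL Lm symL a_gt2 n_le (A := A).
have Cw : C *m w^T = 0 by rewrite -[C]trmxK -trmx_mul wC trmx0.
rewrite -[a.+1]/(1 + a)%N; exists (col_mx v (L *m C)); split.
- case/row_freeP: freeL => D LD; apply/row_freeP.
  exists (row_mx w^T (C^T *m D)); rewrite mul_col_row vw mulmxA vC mul0mx.
  rewrite -mulmxA Cw mulmx0
    -[L *m _ *m _]mulmxA [C *m (_ *m _)]mulmxA C1 mul1mx LD.
  by rewrite -scalar_mx_block.
- rewrite tr_col_mx mul_col_row vv trmx_mul mulmxA vC mul0mx.
  rewrite -mulmxA Cv mulmx0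
    -[L *m _ *m _]mulmxA [C *m (_ *m _)]mulmxA C1 mul1mx LL.
  by rewrite block_mx0.
- move=> A Ab; have [c vA] := vb A Ab; exists c.
  (* Subtracting the eigenvalue on [v] gives an element of [m], and [wL] makes such elements kill
     [L *m C] too. *)
  have Am : A - c%:M \in m.
    rewrite mE mulmxBr vA mul_mx_scalar subrr eqxx andbT memvB //.
    by rewrite -scalemx1 memvZ // maximal_has1.
  suff : col_mx v (L *m C) *m (A - c%:M) = 0.
    by rewrite mulmxBr mul_mx_scalar => /eqP; rewrite subr_eq0 => /eqP.
  move: (A - c%:M) Am => B Am.
  rewrite mul_col_mx vm // -[L *m C *m B]mulmx1 -res !mulmxDr !mulmxA.
  rewrite -[_ *m B *m v^T]mulmxA (isotropic_killedr symm vm Am) mulmx0 mul0mx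
    add0r.
  have -> : L *m C *m B *m w^T = 0.
    have := wL B Am; rewrite wcoordE => /(congr1 trmx).
    by rewrite !trmx_mul trmx0 !trmxK (proj1 symm) // !mulmxA.
  by have := Lm B Am; rewrite compressE !mulmxA mul0mx add0r => ->;
    rewrite mul0mx col_mx0.
Qed.

End ExtremalScalar.

(** * Model spaces and their orthogonal conjugacy *)

Section Models.
Local Open Scope ring_scope.
Variable F : numClosedFieldType.

Definition frame n a r (L : 'M[F]_(a, n)) (E : 'M[F]_(r, n)) : Prop :=
  [/\ row_free L, L *m L^T = 0, E *m E^T = 1%:M & L *m E^T = 0].

(** [x] is the extra operator: [0] for [n] even; for [n] odd, [e^T *m e] or the symmetric product of
    [e] with a vector in the span of [L]. *)
Definition model n a (L : 'M[F]_(a, n)) (x : 'M[F]_n) : {vspace 'M[F]_n} :=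
  (symsq L + <[x]> + <[1%:M]>)%VS.

Definition orthconj n (b b' : {vspace 'M[F]_n}) : Prop :=
  exists2 g : 'M[F]_n, g *m g^T = 1%:M & (compress g^T @: b)%VS = b'.

(** The full frame has a complement of dimension 0, and the vanishing of the projection onto it is
    the last identity. *)
Lemma frame_dual n a r (L : 'M[F]_(a, n)) (E : 'M[F]_(r, n)) :
    n = (a + a + r)%N -> frame L E ->
  exists M : 'M_(a, n),
    [/\ L *m M^T = 1%:M, M *m M^T = 0, M *m E^T = 0 &
        L^T *m M + M^T *m L + E^T *m E = 1%:M].
Proof.
move=> def_n [freeL LL EE LE];
  have [M [LM MM ME]] := isotropic_dual freeL LL EE LE.
exists M; split=> //.
have ML : M *m L^T = 1%:M by rewrite -[M]trmxK -trmx_mul LM trmx1.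
have EL : E *m L^T = 0 by rewrite -[E]trmxK -trmx_mul LE trmx0.
have EM : E *m M^T = 0 by rewrite -[E]trmxK -trmx_mul ME trmx0.
pose Z := col_mx (col_mx L M) E; pose Z' := col_mx (col_mx M L) E.
have [|||C [CC _ _ _]] := @orth_compl F n (a + a + r) 0 Z Z'.
- by rewrite addn0.
- rewrite !tr_col_mx !mul_col_row !mul_col_mx !mul_mx_row MM ML LM LL
  -scalar_mx_block.
  by rewrite ME LE EM EL EE row_mx0 col_mx0 -scalar_mx_block.
- rewrite !tr_col_mx !mul_row_col !linearD /= !trmx_mul !trmxK.
  by congr (_ + _); rewrite addrC.
move: CC; rewrite [C]flatmx0 mulmx0 !tr_col_mx !mul_row_col => /esym/eqP.
by rewrite subr_eq0 => /eqP.
Qed.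

(* g maps the hyperbolic basis (L, M, E) to (L', M', E'). *)
Lemma frame_transitive n a r (L L' : 'M[F]_(a, n)) (E E' : 'M[F]_(r, n)) :
    n = (a + a + r)%N -> frame L E -> frame L' E' ->
  exists g : 'M[F]_n, [/\ g *m g^T = 1%:M, L *m g = L' & E *m g = E'].
Proof.
move=> def_n fLE fLE'.
have [M [LM MM ME res]] := frame_dual def_n fLE.
have [M' [LM' MM' ME' _]] := frame_dual def_n fLE'.
have [_ LL EE LE] := fLE; have [_ LL' EE' LE'] := fLE'.
have flip p q (X : 'M[F]_(p, n)) (Y : 'M[F]_(q, n)) : Y *m X^T = (X *m Y^T)^T.
  by rewrite trmx_mul trmxK.
exists (M^T *m L' + L^T *m M' + E^T *m E'); split.
- rewrite !linearD /= !trmx_mul !trmxK !(mulmxDl, mulmxDr) -!mulmxA.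
  rewrite !(mulmxA L') !(mulmxA M') !(mulmxA E').
  rewrite LL' LM' LE' MM' ME' EE' (flip _ _ L' M') LM' (flip _ _ L' E') LE'.
  rewrite (flip _ _ M' E') ME' !trmx0 trmx1 !(mul0mx, mulmx0, mul1mx, add0r,
    addr0).
  by rewrite -res [X in X + _]addrC.
- by rewrite !mulmxDr !mulmxA LM LL LE mul1mx !mul0mx !addr0.
- by rewrite !mulmxDr !mulmxA (flip _ _ M) (flip _ _ L) ME LE EE !trmx0 mul1mx
  !mul0mx !add0r.
Qed.

Lemma symsq_mull n a (T : 'M[F]_a) (L : 'M[F]_(a, n)) :
  T \in unitmx -> symsq (T *m L) = symsq L.
Proof.
move=> uT; apply/vspaceP=> A; apply/symsqP/symsqP=> -[S symS ->].
  exists (T^T *m S *m T); first by rewrite !trmx_mul trmxK symS mulmxA.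
  by rewrite trmx_mul !mulmxA.
exists ((invmx T)^T *m S *m invmx T).
  by rewrite !trmx_mul trmxK symS mulmxA.
rewrite trmx_mul !mulmxA mulmxKV // -(mulmxA L^T T^T) -trmx_mul mulVmx //.
by rewrite trmx1 mulmx1.
Qed.

Lemma compress_symsq n a (L : 'M[F]_(a, n)) (g : 'M[F]_n) :
  (compress g^T @: symsq L)%VS = symsq (L *m g).
Proof.
apply/vspaceP=> A; apply/memv_imgP/symsqP =>
  [[_ /symsqP[S symS ->] ->]|[S symS ->]].
  by exists S => //; rewrite compressE trmxK trmx_mul !mulmxA.
exists (L^T *m S *m L); first by apply/symsqP; exists S.
by rewrite compressE trmxK trmx_mul !mulmxA.
Qed.

Lemma compress_model n a (L : 'M[F]_(a, n)) x (g : 'M[F]_n) :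
    g *m g^T = 1%:M ->
  (compress g^T @: model L x)%VS = model (L *m g) (g^T *m x *m g).
Proof.
move=> gg; rewrite /model !limgD !limg_line compress_symsq !compressE trmxK.
by rewrite mulmx1 (mulmx1C gg).
Qed.

Lemma model_conj0 n a (L L' : 'M[F]_(a, n)) (E E' : 'M[F]_(0, n)) :
    n = (a + a)%N -> frame L E -> frame L' E' ->
      orthconj (model L 0) (model L' 0).
Proof.
rewrite -[(a + a)%N]addn0 =>
  def_n fLE /(frame_transitive def_n fLE)[g [gg LL' _]].
by exists g; rewrite // compress_model // LL' mulmx0 mul0mx.
Qed.

Lemma model_conj1 n a (L L' : 'M[F]_(a, n)) (e e' : 'rV[F]_n) :
    n = (a + a + 1)%N -> frame L e -> frame L' e' ->
  orthconj (model L (e^T *m e)) (model L' (e'^T *m e')).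
Proof.
move=> def_n fLE /(frame_transitive def_n fLE)[g [gg LL' <-]].
by exists g; rewrite // compress_model // LL' trmx_mul !mulmxA.
Qed.

Definition symprod n (x y : 'rV[F]_n) : 'M[F]_n := x^T *m y + y^T *m x.

Lemma row_transitive a (y y' : 'rV[F]_a) : y != 0 -> y' != 0 ->
  exists2 T : 'M_a, T \in unitmx & y *m T = y'.
Proof.
move=> y0 y0'; have [z yz] := row_dual y0.
have [|T uT yT] := @complete_unitmx F 1 a y (z^T *m y').
  by rewrite mulmxA yz mul1mx !rank_rV y0 y0'.
by exists T; rewrite // -yT mulmxA yz mul1mx.
Qed.

(** [symsq] depends only on the row space, so [L'] may first be replaced by [T *m L'] with
    [y *m T = y']. *)
Lemma model_conj2 n a (L L' : 'M[F]_(a,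
  n)) (e e' : 'rV[F]_n) (y y' : 'rV[F]_a) :
    n = (a + a + 1)%N -> frame L e -> frame L' e' -> y != 0 -> y' != 0 ->
  orthconj (model L (symprod e (y *m L))) (model L' (symprod e' (y' *m L'))).
Proof.
move=> def_n fLE [freeL' LL' ee' Le'] y0 y0'.
have [T uT yT] := row_transitive y0 y0'.
have fTL : frame (T *m L') e'.
  split=> //; last by rewrite -mulmxA Le' mulmx0.
    by rewrite /row_free mxrankMfree // -row_free_unit in uT *.
  by rewrite trmx_mul mulmxA -(mulmxA T) LL' mulmx0 mul0mx.
have [g [gg LTL <-]] := frame_transitive def_n fLE fTL.
exists g; rewrite // compress_model // LTL -yT /model symsq_mull //.
congr (_ + <[_]> + _)%VS; rewrite /symprod mulmxDr mulmxDl.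
by rewrite -[y *m T *m L']mulmxA -LTL !trmx_mul !mulmxA.
Qed.

End Models.

(** * Classification of the extremal spaces *)

Section ExtremalModels.
Local Open Scope ring_scope.
Variable F : numClosedFieldType.

Lemma symsq_killed n a (L : 'M[F]_(a, n)) A :
  L *m L^T = 0 -> A \in symsq L -> L *m A = 0.
Proof. by move=> LL /symsqP[S _ ->]; rewrite !mulmxA LL !mul0mx. Qed.

Lemma symsq_sym n a (L : 'M[F]_(a, n)) A : A \in symsq L -> A^T = A.
Proof. by case/symsqP=> S symS ->; rewrite !trmx_mul trmxK symS mulmxA. Qed.

Lemma killed_model n a (L : 'M[F]_(a, n)) x A : L *m L^T = 0 -> L *m x = 0 ->
  A \in (symsq L + <[x]>)%VS -> L *m A = 0.
Proof.
move=> LL Lx /memv_addP[B BL [_ /vlineP[c ->] ->]].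
by rewrite mulmxDr symsq_killed // -scalemxAr Lx scaler0 addr0.
Qed.

(** Apart from the scalars, the product of two elements is a multiple of [x *m x]: factors from
    [symsq L] annihilate one another and [x]. *)
Lemma commsym_model n a (L : 'M[F]_(a, n)) x :
  L *m L^T = 0 -> L *m x = 0 -> x^T = x -> commsym (model L x).
Proof.
move=> LL Lx symx; apply: commsym_add1.
have xL : x *m L^T = 0 by apply: killed_right.
have mulE B c B' c' : B \in symsq L -> B' \in symsq L ->
    (B + c *: x) *m (B' + c' *: x) = (c * c') *: (x *m x).
  move=> BL BL'; rewrite mulmxDr -scalemxAr !mulmxDl -!scalemxAl.
  case/symsqP: BL => S symS ->; case/symsqP: BL' => S' symS' ->.
  rewrite -[L^T *m S *m L *m x]mulmxA Lx mulmx0 add0r scalerA mulrC !mulmxA xL.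
  by rewrite -[_ *m L *m L^T]mulmxA LL !(mulmx0, mul0mx) scaler0 !add0r.
split=> [_ /memv_addP[B BL [_ /vlineP[c ->] ->]]|].
  by rewrite linearD linearZ /= symx (symsq_sym BL).
move=> _ _ /memv_addP[B BL [_ /vlineP[c ->]
  ->]] /memv_addP[B' BL' [_ /vlineP[c' ->] ->]].
by rewrite !mulE // mulrC.
Qed.

Lemma dim_model n a (L : 'M[F]_(a, n)) x :
    L != 0 -> L *m L^T = 0 -> L *m x = 0 ->
  \dim (model L x) = (\dim (symsq L + <[x]>)).+1.
Proof. by move=> L0 LL Lx;
  apply: (dim_killed_add1 L0) => A /killed_model->. Qed.

Lemma model_maxdim0 n a (L : 'M[F]_(a, n)) :
    n = (a + a)%N -> (0 < a)%N -> row_free L -> L *m L^T = 0 ->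
  commsym (model L 0) /\ \dim (model L 0) = maxdim n.
Proof.
move=> def_n a_gt0 freeL LL; have L0 : L != 0.
  by rewrite -mxrank_eq0 (eqP freeL) -lt0n.
have -> : maxdim n = 'C(a.+1,
  2).+1 by rewrite def_n -[(a + a)%N]addn0 maxdimE // addn0 addn1.
split; first by apply: commsym_model; rewrite ?mulmx0 ?trmx0.
rewrite dim_model ?mulmx0 //; congr _.+1.
suff -> : (symsq L + <[0]>)%VS = symsq L by rewrite dim_symsq.
by apply/addv_idPl; rewrite -memvE mem0v.
Qed.

(** [e] detects the extra operator: it kills [symsq L] but not [x]. *)
Lemma model_maxdim1 n a (L : 'M[F]_(a, n)) (e : 'rV_n) (x : 'M_n) :
    n = (a + a + 1)%N -> (0 < a)%N -> row_free L -> L *m L^T = 0 ->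
    L *m x = 0 -> L *m e^T = 0 -> e *m x != 0 -> x^T = x ->
  commsym (model L x) /\ \dim (model L x) = maxdim n.
Proof.
move=> def_n a_gt0 freeL LL Lx Le ex symx; have L0 : L != 0.
  by rewrite -mxrank_eq0 (eqP freeL) -lt0n.
split; first exact: commsym_model.
have -> : maxdim n = 'C(a.+1, 2).+2 by rewrite def_n maxdimE // !addn1.
rewrite dim_model // dim_add_line ?dim_symsq //.
apply: contra ex => /symsqP[S _ ->].
by rewrite !mulmxA -[e]trmxK -[_ *m L^T]trmx_mul Le trmx0 !mul0mx.
Qed.

(** As [b] contains the scalars, subtracting eigenvalues splits it into the scalars and the
    annihilator [m] of [L], which is large enough for [symsq_sub]. *)
Lemma extremal_killed a r n (b : {vspace 'M[F]_n}) :
    (2 < a)%N -> n = (a + a + r)%N -> (r <= 1)%N -> commsym b ->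
    (maxdim n <= \dim b)%N ->
  exists L : 'M_(a, n), exists m : {vspace 'M_n},
    [/\ row_free L /\ L *m L^T = 0, commsym m, forall A, A \in m -> L *m A = 0,
        b = (m + <[1%:M]>)%VS & (symsq L <= m)%VS].
Proof.
move=> a_gt2 def_n r_le1 symb max; have b1 := maximal_has1 symb max.
have [L [freeL LL Lb]] := extremal_scalar a_gt2 def_n r_le1 symb max.
pose m := (b :&: lker (linfun (mulmx L)))%VS.
have mE A : (A \in m) = (A \in b) && (L *m A == 0).
  by rewrite memv_cap memv_ker lfunE.
have Lm A : A \in m -> L *m A = 0 by rewrite mE => /andP[_ /eqP].
have symm : commsym m by apply: commsymS symb; apply: capvSl.
have def_b : b = (m + <[1%:M]>)%VS.
  apply/eqP; rewrite eqEsubv subv_add capvSl -memvE b1 !andbT.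
  apply/subvP=> A Ab; have [c LA] := Lb A Ab.
  rewrite -(subrK c%:M A) memv_add //;
    last by rewrite -scalemx1 memvZ ?memv_line.
  rewrite mE mulmxBr LA mul_mx_scalar subrr eqxx andbT memvB //.
  by rewrite -scalemx1 memvZ.
exists L, m; split=> //.
have [M [E [_ _ res]]] := isotropic_frame def_n freeL LL.
apply: (symsq_sub res symm Lm r_le1).
have maxn : maxdim n = ('C(a.+1, 2) + r + 1)%N.
  by rewrite def_n maxdimE //; lia.
move: max; rewrite maxn [in \dim b]def_b.
have : (\dim (m + <[1%:M]>) <= \dim m + 1)%N.
  by rewrite (leq_trans (dimv_add_leqif _ _)) // leq_add2l dim_vline leq_b1.
lia.
Qed.

Lemma extremal_model0 a n (b : {vspace 'M[F]_n}) :
    (2 < a)%N -> n = (a + a)%N -> commsym b -> (maxdim n <= \dim b)%N ->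
  exists L : 'M_(a, n), exists E : 'M_(0, n), frame L E /\ b = model L 0.
Proof.
rewrite -[(a + a)%N]addn0 => a_gt2 def_n symb max.
have [L [m [[freeL LL] symm Lm -> subL]]] :=
  extremal_killed a_gt2 def_n isT symb max.
have [M [E [_ [EE LE _] res]]] := isotropic_frame def_n freeL LL.
exists L, E; split=> //; congr (_ + _)%VS; apply/eqP;
  rewrite eqEsubv subv_add subL.
rewrite -memvE mem0v !andbT; apply: (@subv_trans _ _ (symsq L));
  last exact: addvSl.
apply/subvP=> A Am; apply: (killed_symsq res) (Lm A Am) _.
  exact: (proj1 symm).
exact: flatmx0.
Qed.

Lemma addv_line_eq (V : vectType F) (U : {vspace V}) u c x :
  u \in U -> c != 0 -> (U + <[u + (c *: x)%R]> = U + <[x]>)%VS.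
Proof.
move=> uU c0; apply/eqP; rewrite eqEsubv !subv_add !addvSl -!memvE /=.
apply/andP; split; first by rewrite memv_add // memvZ ?memv_line.
have xE : (x = c^-1 *: - u + c^-1 *: (u + c *: x))%R.
  by rewrite -scalerDr addKr scalerA mulVf // scale1r.
by rewrite [X in X \in _]xE memv_add // memvZ ?memvN ?memv_line.
Qed.

Lemma symprod_sym n (x y : 'rV[F]_n) : (symprod x y)^T = symprod x y.
Proof. by rewrite linearD /= !trmx_mul !trmxK addrC. Qed.

(** The dimension leaves one operator [A] outside [symsq L]. Modulo [symsq L] it is
    [t *: (e^T *m e)] plus [symprod e (y *m L)]; the two models correspond to [t != 0] and
    [t = 0]. *)
Lemma extremal_model1 a n (b : {vspace 'M[F]_n}) :
    (2 < a)%N -> n = (a + a + 1)%N -> commsym b -> (maxdim n <= \dim b)%N ->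
  exists L : 'M_(a, n), exists e : 'rV_n, frame L e /\
    (b = model L (e^T *m e) \/
     exists2 y : 'rV_a, y != 0 & b = model L (symprod e (y *m L))).
Proof.
move=> a_gt2 def_n symb max; have a_gt0 : (0 < a)%N by lia.
have [L [m [[freeL LL] symm Lm def_b subL]]] :=
  extremal_killed a_gt2 def_n isT symb max.
have [M [e [[LM MM Me] [ee Le eL] res]]] := isotropic_frame def_n freeL LL.
have [A Am AL] : exists2 A, A \in m & A \notin symsq L.
  apply/subvPn/negP=> /dimvS; rewrite dim_symsq // leqNgt => /negP[].
  have maxn : maxdim n = 'C(a.+1, 2).+2 by rewrite def_n maxdimE // !addn1.
  move: max; rewrite maxn def_b.
  have : (\dim (m + <[1%:M]>) <= \dim m + 1)%N.
    by rewrite (leq_trans (dimv_add_leqif _ _)) // leq_add2l dim_vline leq_b1.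
  by move=> /[swap] /leq_trans/[apply]; rewrite addn1 ltnS.
have symA := proj1 symm A Am; have LA := Lm A Am.
have def_m : m = (symsq L + <[A]>)%VS.
  apply/esym/eqP; rewrite eqEdim subv_add subL -memvE Am dim_add_line //=.
  rewrite (leq_trans (dim_killed res symm Lm isT)) // addn1 ltnS.
  exact/dimvS/capvSr.
rewrite {}def_m in def_b.
(* The components of [e *m A] along [e] and along [L]. *)
pose t := (e *m A *m e^T) 0 0; pose y := e *m A *m M^T.
have eAe : e *m A *m e^T = t%:M by rewrite [LHS]mx11_scalar.
have eA : e *m A = y *m L + t *: e.
  rewrite {1}(killed_expand res symA LA) mulmxDr !mulmxA eAe mul_scalar_mx.
  by [].
pose s := A - (symprod e (y *m L) + t *: (e^T *m e)).
have sL : s \in symsq L.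
  apply: (killed_symsq res).
  - have xE : (symprod e (y *m L) + t *: (e^T *m e))^T =
        symprod e (y *m L) + t *: (e^T *m e).
      by rewrite linearD linearZ /= symprod_sym trmx_mul trmxK.
    by rewrite [s^T]linearB /= xE symA.
  - rewrite /s /symprod mulmxBr !mulmxDr LA -scalemxAr trmx_mul !mulmxA Le LL.
    by rewrite !mul0mx scaler0 !addr0 subr0.
  - rewrite /s /symprod mulmxBr !mulmxDr eA -scalemxAr trmx_mul !mulmxA ee eL.
    by rewrite !mul0mx !mul1mx addr0 subrr.
have AE : A = s + (symprod e (y *m L) + t *: (e^T *m e)) by rewrite subrK.
exists L; have [t0|t0] := eqVneq t 0.
  exists e; split; first by split.
  right; exists y.
    apply: contraNneq AL => y0.
    by rewrite AE y0 t0 /symprod mul0mx trmx0 mulmx0 mul0mx scale0r !addr0.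
  rewrite def_b /model; congr (_ + _)%VS.
  by rewrite AE t0 scale0r addr0
    -[symprod _ _]scale1r addv_line_eq ?oner_eq0 // scale1r.
(* Completing the square: [k] is isotropic and orthogonal to [e], so [e'] is again a unit vector,
   and the leftover [k^T *m k] lies in [symsq L]. *)
pose k := y *m L; pose e' := e + t^-1 *: k.
have kk : k *m k^T = 0 by rewrite trmx_mul mulmxA -(mulmxA y) LL mulmx0 mul0mx.
have ke : k *m e^T = 0 by rewrite -mulmxA Le mulmx0.
have ek : e *m k^T = 0 by rewrite -[e]trmxK -trmx_mul ke trmx0.
have kL : k^T *m k \in symsq L.
  apply/symsqP; exists (y^T *m y); first by rewrite trmx_mul trmxK.
  by rewrite trmx_mul !mulmxA.
have eT : e'^T = e^T + t^-1 *: k^T by rewrite linearD linearZ.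
exists e'; split.
  split=> //; rewrite eT.
    rewrite mulmxDr !mulmxDl -!scalemxAr -!scalemxAl ee ke ek kk.
    by rewrite !scaler0 !addr0.
  by rewrite mulmxDr Le -scalemxAr trmx_mul mulmxA LL mul0mx scaler0 addr0.
left; rewrite def_b /model; congr (_ + _)%VS.
have -> : A = (s - t^-1 *: (k^T *m k)) + t *: (e'^T *m e').
  have -> : t *: (e'^T *m e') =
    symprod e k + t *: (e^T *m e) + t^-1 *: (k^T *m k).
    rewrite eT mulmxDr !mulmxDl -!scalemxAr
      -!scalemxAl !scalerDr !scalerA !mulrA.
    rewrite divff // !mul1r !scale1r /symprod.
    by rewrite [LHS](AC (2*2) (3*2*1*4)).
  by rewrite addrACA addNr addr0 -AE.
by rewrite addv_line_eq // memvB // memvZ.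
Qed.

(** Apart from its scalar [c], an element squares to a multiple of [k^T *m k] with [k = y *m L],
    which it annihilates as [k] is orthogonal to itself, to [e] and to [L]. *)
Lemma model_cube n a (L : 'M[F]_(a, n)) (e : 'rV_n) (y : 'rV_a) A :
    frame L e -> A \in model L (symprod e (y *m L)) ->
  exists c, let D := A - c%:M in D *m D *m D = 0.
Proof.
move=> [_ LL ee Le] /memv_addP[B + [_ /vlineP[c ->] ->]].
case/memv_addP=> B' /symsqP[S symS ->] [_ /vlineP[d ->] ->].
exists c; rewrite scalemx1 addrK /=; set k := y *m L.
have Lk : L *m k^T = 0 by rewrite trmx_mul mulmxA LL mul0mx.
have eL : e *m L^T = 0 by rewrite -[e]trmxK -trmx_mul Le trmx0.
have kL : k *m L^T = 0 by rewrite -mulmxA LL mulmx0.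
have kk : k *m k^T = 0 by rewrite {1}/k -mulmxA Lk mulmx0.
have ke : k *m e^T = 0 by rewrite -mulmxA Le mulmx0.
have ek : e *m k^T = 0 by rewrite -[e]trmxK -trmx_mul ke trmx0.
clearbody k; have Lx : L *m symprod e k = 0.
  by rewrite mulmxDr !mulmxA Le Lk !mul0mx addr0.
have kx : k *m symprod e k = 0.
  by rewrite mulmxDr !mulmxA ke kk !mul0mx addr0.
have ex : e *m symprod e k = k.
  by rewrite mulmxDr !mulmxA ee ek mul1mx mul0mx addr0.
have xL : symprod e k *m L^T = 0.
  by rewrite mulmxDl -!mulmxA eL kL !mulmx0 addr0.
have xx : symprod e k *m symprod e k = k^T *m k.
  by rewrite {1}/symprod mulmxDl -!mulmxA kx ex mulmx0 add0r.
have -> : (L^T *m S *m L + d *: symprod e k) *m (L^T *m S *m L + d *: symprod e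
  k)
    = (d * d) *: (k^T *m k).
  rewrite mulmxDr !mulmxDl -!scalemxAr -!scalemxAl xx scalerA
    -[_ *m L *m symprod _ _]mulmxA Lx.
  by rewrite !mulmxA xL -[_ *m L *m L^T]mulmxA LL !(mulmx0,
    mul0mx) !scaler0 !add0r.
rewrite -scalemxAl mulmxDr -scalemxAr -!mulmxA kx [k *m (L^T *m _)]mulmxA kL.
by rewrite !(mulmx0, mul0mx) scaler0 addr0 scaler0.
Qed.

(** If [D^3 = 0], then [p D^3 = (1 - c)^3 p] forces [c = 1]; but then [D^3 = D], which is
    nonzero. *)
Lemma projection_cube n (p : 'M[F]_n) c : p *m p = p -> p != 0 -> p != 1%:M ->
  let D := p - c%:M in D *m D *m D != 0.
Proof.
move=> pp p0 p1 /=.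
have pD : p *m (p - c%:M) = (1 - c) *: p.
  by rewrite mulmxBr pp mul_mx_scalar scalerBl scale1r.
apply/negP=> /eqP D0.
have c1 : c = 1.
  have : p *m ((p - c%:M) *m (p - c%:M) *m (p - c%:M)) = 0 by rewrite D0 mulmx0.
  rewrite !mulmxA !(pD, =^~ scalemxAl) !scalerA => /eqP.
  by rewrite scaler_eq0 (negPf p0) orbF !mulf_eq0 !orbb subr_eq0 => /eqP.
case/eqP: p1; move: D0; rewrite {}c1 => D0.
have DD : (p - 1%:M) *m (p - 1%:M) = - (p - 1%:M).
  by rewrite mulmxBl mul1mx mulmxBr pp mulmx1 subrr sub0r.
move: D0; rewrite DD mulNmx DD opprK => /eqP.
by rewrite subr_eq0 => /eqP.
Qed.

Lemma frame_exists n a r : n = (a + a + r)%N ->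
  exists L : 'M[F]_(a, n), exists E : 'M[F]_(r, n), frame L E.
Proof.
(* The rows of [(1, i, 0)] are isotropic because [1 + i^2 = 0]. *)
move=> ->; exists (row_mx (row_mx 1%:M ('i%:M)) 0), (row_mx 0 1%:M); split.
- apply/row_freeP; exists (col_mx (col_mx 1%:M 0) 0).
  by rewrite !mul_row_col mul1mx !mulmx0 !addr0.
- rewrite !tr_row_mx !mul_row_col !trmx1 tr_scalar_mx mul1mx mul0mx.
  by rewrite -scalar_mxM -expr2 sqrCi addr0 -raddfD /= subrr raddf0.
- by rewrite tr_row_mx mul_row_col trmx1 mul1mx mul0mx add0r.
- by rewrite tr_row_mx mul_row_col trmx0 mulmx0 mul0mx addr0.
Qed.

Lemma unit_row_neq0 n (e : 'rV[F]_n) : e *m e^T = 1%:M -> e != 0.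
Proof.
move=> ee; apply: contra_eq_neq ee => ->; rewrite mul0mx eq_sym.
by rewrite -mxrank_eq0 mxrank1.
Qed.

Section Frame.
Variables (n a : nat) (L : 'M[F]_(a, n)) (e : 'rV[F]_n).
Hypothesis def_n : n = (a + a + 1)%N.
Hypothesis a_gt0 : (0 < a)%N.
Hypothesis fLe : frame L e.

Lemma frame_L0 : L != 0.
Proof. by case: fLe => freeL _ _ _; rewrite -mxrank_eq0 (eqP freeL) -lt0n. Qed.

Lemma model_projection_maxdim :
  commsym (model L (e^T *m e)) /\ \dim (model L (e^T *m e)) = maxdim n.
Proof.
case: fLe => freeL LL ee Le; apply: (model_maxdim1 (e := e)) => //.
- by rewrite mulmxA Le mul0mx.
- by rewrite mulmxA ee mul1mx unit_row_neq0.
- by rewrite trmx_mul trmxK.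
Qed.

Lemma model_symprod_maxdim (y : 'rV_a) : y != 0 ->
  let b := model L (symprod e (y *m L)) in commsym b /\ \dim b = maxdim n.
Proof.
case: fLe => freeL LL ee Le y0; apply: (model_maxdim1 (e := e)) => //.
- by rewrite mulmxDr !mulmxA Le trmx_mul mulmxA LL !mul0mx addr0.
- have eL : e *m L^T = 0 by rewrite -[e]trmxK -trmx_mul Le trmx0.
  rewrite mulmxDr !mulmxA ee mul1mx trmx_mul mulmxA eL !mul0mx addr0.
  apply: contra_neq y0 => yL; apply: (row_free_inj freeL).
  by rewrite yL mul0mx.
- exact: symprod_sym.
Qed.

(** Even an arbitrary invertible [h] cannot intertwine the two: the nontrivial projection [p] would
    be similar to a scalar plus a matrix of cube zero. *)
Lemma model_nonconj (y : 'rV_a) (h : 'M_n) : h \in unitmx ->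
  ~ (forall A, A \in model L (e^T *m e) ->
       exists2 A', A' \in model L (symprod e (y *m L)) & h *m A' = A *m h).
Proof.
move=> uh conj; case: fLe => freeL LL ee Le; set p := e^T *m e in conj.
have [|A' A'b hA'] := conj p.
  by rewrite /model memvE (subv_trans _ (addvSl _ _)) // addvSr.
have [c] := model_cube fLe A'b; set D := A' - c%:M => D0.
have hD : (p - c%:M) *m h = h *m D.
  by rewrite mulmxBl mulmxBr hA' mul_mx_scalar mul_scalar_mx.
have pp : p *m p = p by rewrite /p mulmxA -[_ *m e *m _]mulmxA ee mulmx1.
have p0 : p != 0.
  apply: contraNneq (unit_row_neq0 ee) => p0.
  by rewrite -[e]mul1mx -ee -mulmxA -/p p0 mulmx0.
have p1 : p != 1%:M.
  apply: contraNneq frame_L0 => p1.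
  by rewrite -[L]mulmx1 -p1 /p mulmxA Le mul0mx.
have /= /negP[] := projection_cube c pp p0 p1.
apply/eqP; move: (p - c%:M) hD => P hD.
have PPP : P *m P *m P *m h = h *m (D *m D *m D).
  by rewrite -!mulmxA hD (mulmxA P h) hD -mulmxA (mulmxA P h) hD !mulmxA.
by rewrite -[LHS](mulmxK uh) PPP D0 mulmx0 mul0mx.
Qed.

End Frame.

Lemma commsym_maxdim_exists n : (0 < n)%N ->
  exists2 b : {vspace 'M[F]_n}, commsym b & \dim b = maxdim n.
Proof.
move=> n_gt0; case: (evenVodd n) => -[a]; rewrite -addnn.
  rewrite -[(a + a)%N]addn0 => def_n;
    have [L [E [freeL LL _ _]]] := frame_exists def_n.
  rewrite addn0 in def_n.
  by have [|? ?] := model_maxdim0 def_n _ freeL LL; [lia | exists (model L 0)].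
rewrite -addn1; case: a => [|a] def_n.
  (* For [n = 1] the scalars already attain the bound. *)
  exists <[1%:M]>%VS.
    rewrite -[<[_]>%VS]add0v; apply: commsym_add1.
    by split=> [A|A B]; rewrite memv0 => /eqP->;
      rewrite ?trmx0 // mul0mx mulmx0.
  rewrite dim_vline def_n -mxrank_eq0 mxrank1 //.
have [L [e fLe]] := frame_exists def_n.
by have [] := model_projection_maxdim def_n isT fLe;
  exists (model L (e^T *m e)).
Qed.

End ExtremalModels.

(** * From matrices to infinitesimal variations *)

Section Chain.
Local Open Scope ring_scope.
Variables (F : numClosedFieldType) (V : vectType F) (n k : nat).
Variables (Q : {biscalar V}) (N : 'End(V)) (T : 'Hom('rV[F]_n, V)).

(** [t] counts steps down from the top: if [T] parametrizes J^{k,k}, then [chain t] parametrizes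
    J^{k-t,k-t}. *)
Fixpoint chain t : 'Hom('rV[F]_n, V) :=
  if t is t'.+1 then (N \o chain t')%VF else T.

Lemma chainS t x : chain t.+1 x = N (chain t x).
Proof. by rewrite /= comp_lfunE. Qed.

Hypothesis skewN : forall u v, Q (N u) v = - Q u (N v).
Hypothesis chainQ : forall s x y,
  Q (T x) (chain s y) = if s == k then (x *m y^T) 0 0 else 0.
Hypothesis chain_span : forall u, exists x : 'I_k.+1 -> 'rV[F]_n,
  u = \sum_(t < k.+1) chain t (x t).
Hypothesis chain_end : forall x, chain k.+1 x = 0.

Lemma chainQE t s x y : Q (chain t x) (chain s y) =
  if (t + s)%N == k then (-1) ^+ t * (x *m y^T) 0 0 else 0.
Proof.
elim: t s => [|t IH] s; first by rewrite chainQ mul1r.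
rewrite chainS skewN -chainS IH addnS addSn.
by case: ifP; rewrite ?oppr0 // exprS mulN1r mulNr.
Qed.

Lemma chain_ind (P : V -> Prop) :
    P 0 -> (forall u v, P u -> P v -> P (u + v)) ->
    (forall t x, (t <= k)%N -> P (chain t x)) ->
  forall u, P u.
Proof.
move=> P0 PD Pch u; have [x ->] := chain_span u.
by apply: (big_ind P) => // t _; apply: Pch; rewrite -ltnS.
Qed.

Lemma chain_ext (W : vectType F) (f g : 'Hom(V, W)) :
  (forall t x, (t <= k)%N -> f (chain t x) = g (chain t x)) -> f = g.
Proof.
move=> fg; apply/lfunP; apply: chain_ind => //; first by rewrite !linear0.
by move=> u v fu fv; rewrite !linearD /= fu fv.
Qed.

(* The coefficients of u in V = (+)_t N^t T(F^n); they are read off by pairing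
   with N^(k - t) T. *)
Definition chain_coord t (u : V) : 'rV[F]_n :=
  \row_i ((-1) ^+ t * Q u (chain (k - t) (delta_mx 0 i))).

Fact chain_coord_is_linear t : linear (chain_coord t).
Proof.
move=> c u v; apply/rowP=> i; rewrite !mxE linearPl /=.
by rewrite mulrDr mulrCA.
Qed.

HB.instance Definition _ t :=
  GRing.isLinear.Build F V 'rV[F]_n *:%R (chain_coord t) (chain_coord_is_linear
    t).

Lemma chain_coordK t s x : (t <= k)%N -> (s <= k)%N ->
  chain_coord t (chain s x) = if t == s then x else 0.
Proof.
move=> t_le s_le; apply/rowP=> i; rewrite mxE chainQE.
have -> : ((s + (k - t))%N == k) = (t == s) by apply/eqP/eqP; lia.
case: eqP => [->|_]; last by rewrite mulr0 mxE.
rewrite mulrA -exprD -signr_odd oddD addbb mul1r trmx_delta -colE mxE //.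
Qed.

(* Matrices act on row vectors from the right, so act reverses products. *)
Definition act (A : 'M[F]_n) : 'End(V) :=
  \sum_(t < k.+1) (chain t \o linfun (mulmxr A \o chain_coord t))%VF.

Lemma act_chain A t x : (t <= k)%N -> act A (chain t x) = chain t (x *m A).
Proof.
rewrite -ltnS => t_lt; rewrite sum_lfunE (bigD1 (Ordinal t_lt)) //= big1.
  by rewrite comp_lfunE lfunE /= chain_coordK // eqxx addr0.
move=> s; rewrite comp_lfunE lfunE /= chain_coordK //; last exact: ltn_ord s.
rewrite -(inj_eq val_inj) /= => /negPf->.
by rewrite mul0mx linear0.
Qed.

(** The range includes [t = k.+1], where both sides vanish, so that commutation with [N] can be
    checked at [t = k]. *)
Lemma act_chain_all A t x : (t <= k.+1)%N -> act A (chain t x) =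
  chain t (x *m A).
Proof.
by rewrite leq_eqVlt => /predU1P[->|/act_chain->//]; rewrite !chain_end linear0.
Qed.

Lemma actM A B : (act A \o act B)%VF = act (B *m A).
Proof.
by apply: chain_ext => t x t_le; rewrite comp_lfunE !act_chain // mulmxA.
Qed.

Lemma act1 : act 1%:M = \1%VF.
Proof.
by apply: chain_ext => t x t_le; rewrite act_chain // mulmx1 id_lfunE.
Qed.

Lemma act_comm A : (act A \o N)%VF = (N \o act A)%VF.
Proof.
apply: chain_ext => t x t_le.
by rewrite !comp_lfunE -chainS act_chain_all // act_chain // chainS.
Qed.

(** The same matrix [A] is used between any two consecutive levels, which is what commutation with
    [N] imposes ([comm_shift]). *)
Definition shift A : 'End(V) := (N \o act A)%VF.

Lemma shift_chain A t x : (t <= k)%N -> shift A (chain t x) =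
  chain t.+1 (x *m A).
Proof. by move=> t_le; rewrite comp_lfunE act_chain // chainS. Qed.

Lemma shift1 : shift 1%:M = N.
Proof. by rewrite /shift act1 comp_lfun1r. Qed.

Fact shift_is_linear : linear shift.
Proof.
move=> c A B; apply: chain_ext => t x t_le.
by rewrite add_lfunE scale_lfunE !shift_chain // mulmxDr -scalemxAr linearP.
Qed.

HB.instance Definition _ :=
  GRing.isLinear.Build F 'M[F]_n 'End(V) *:%R shift shift_is_linear.

Definition shiftl : 'Hom('M[F]_n, 'End(V)) := linfun shift.

Lemma shiftlE A : shiftl A = shift A.
Proof. by rewrite lfunE. Qed.

Lemma chain_inj t x y : (t <= k)%N -> chain t x = chain t y -> x = y.
Proof.
by move=> t_le /(congr1 (chain_coord t)); rewrite !chain_coordK // eqxx.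
Qed.

Lemma shift_inj : (0 < k)%N -> lker shiftl == 0%VS.
Proof.
move=> k_gt0; apply/lker0P=> A B; rewrite !shiftlE => AB.
apply/row_matrixP=> i; rewrite !rowE; apply: (@chain_inj 1) => //.
by rewrite -!(@shift_chain _ 0) // AB.
Qed.

(** A product goes down two levels, so commuting shifts constrain the matrices only when
    [k >= 2]. *)
Lemma shift_mul A B : (shift A \o shift B)%VF = (N \o N \o act (B *m A))%VF.
Proof.
by rewrite /shift -!comp_lfunA (comp_lfunA (act A)) act_comm
  -(comp_lfunA N) actM.
Qed.

Lemma chain_ind2 (P : V -> V -> Prop) :
    (forall v, P 0 v) -> (forall u, P u 0) ->
    (forall u u' v, P u v -> P u' v -> P (u + u') v) ->
    (forall u v v', P u v -> P u v' -> P u (v + v')) ->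
    (forall t s x y, (t <= k)%N -> (s <= k)%N -> P (chain t x) (chain s y)) ->
  forall u v, P u v.
Proof.
move=> P0l P0r PDl PDr Pch u v; elim/chain_ind: u => // [u u'|t x t_le].
  exact: PDl.
by elim/chain_ind: v => // [v v'|s y s_le]; [apply: PDr | apply: Pch].
Qed.

Lemma shift_lie A : A^T = A -> forall u v,
  Q (shift A u) v + Q u (shift A v) = 0.
Proof.
move=> symA; apply: chain_ind2 =>
  [v|u|u u' v uv u'v|u v v' uv uv'|t s x y t_le s_le].
- by rewrite linear0 !linear0l addr0.
- by rewrite !linear0 addr0.
- by rewrite linearD !linearDl addrACA uv u'v addr0.
- by rewrite !linearD addrACA uv uv' addr0.
rewrite !shift_chain // !chainQE addSnnS; case: ifP => _; last by rewrite addr0.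
by rewrite trmx_mul symA !mulmxA exprS mulN1r mulNr addNr.
Qed.

(** Pairing level 0 with level [k - 1] reads off the entries of [A]; the sign from moving [N] across
    turns skewness into symmetry. *)
Lemma lie_shift A : (0 < k)%N ->
  (forall u v, Q (shift A u) v + Q u (shift A v) = 0) -> A^T = A.
Proof.
move=> k_gt0 lieA; apply/matrixP=> i j.
have := lieA (chain 0 (delta_mx 0 j)) (chain k.-1 (delta_mx 0 i)).
rewrite !shift_chain // ?leq_pred // !chainQE add1n prednK // !eqxx.
rewrite mul1r expr1 mulN1r trmx_mul !trmx_delta -!mulmxA -!rowE -!colE.
by rewrite addrC => /eqP; rewrite subr_eq0 => /eqP; rewrite !mxE.
Qed.

Lemma act_isometry g : g *m g^T = 1%:M -> forall u v,
  Q (act g u) (act g v) = Q u v.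
Proof.
move=> gg; apply: chain_ind2 =>
  [v|u|u u' v uv u'v|u v v' uv uv'|t s x y t_le s_le].
- by rewrite linear0 !linear0l.
- by rewrite !linear0.
- by rewrite linearD !linearDl uv u'v.
- by rewrite !linearD /= uv uv'.
by rewrite !act_chain // !chainQE trmx_mul mulmxA -(mulmxA x) gg mulmx1.
Qed.

(** [A] is read off between the two top levels, and commutation with [N] propagates it down the
    chain. *)
Lemma comm_shift X : (0 < k)%N -> (X \o N)%VF = (N \o X)%VF ->
    (X @: limg T <= limg (chain 1))%VS ->
  exists A, X = shift A.
Proof.
move=> k_gt0 XN XT; pose f x := chain_coord 1 (X (T x)).
have fE x : X (T x) = chain 1 (f x).
  have : X (T x) \in limg (chain 1).
    by apply: (subvP XT); rewrite memv_img // memv_img // memvf.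
  by case/memv_imgP=> y _; rewrite /f => ->; rewrite chain_coordK // eqxx.
pose A := \matrix_i f (delta_mx 0 i).
have fA x : f x = x *m A.
  rewrite mulmx_sum_row {1}[x]row_sum_delta /f !linear_sum.
  by apply: eq_bigr => i _; rewrite !linearZ /= rowK.
exists A; apply: chain_ext => t x; elim: t => [|t IH] t_le.
  by rewrite shift_chain //= fE fA.
rewrite [in LHS]chainS -comp_lfunE XN comp_lfunE IH 1?ltnW //.
by rewrite (shift_chain _ _ (ltnW t_le)) shift_chain // -chainS.
Qed.

End Chain.

(** * An orthonormal basis of the top piece *)

Section OrthonormalChain.
Local Open Scope ring_scope.
Variables (R : realType) (VR : vectType R) (k n : nat).
Local Notation V := (complexification VR).
Local Notation F := R[i].
Variables (Q : {biscalar V}) (J : nat -> {vspace V}) (N : 'End(V)).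
Hypothesis orb : hodge_tate_orbit k n Q J N.

Lemma orbit_skew u v : Q (N u) v = - Q u (N v).
Proof. by apply/eqP; rewrite -addr_eq0; apply/eqP;
  case: (orbit_lie orb) => ->. Qed.

Section Basis.
Variable T : 'Hom('rV[F]_n, V).
Hypothesis limgT : limg T = J k.

Lemma orbit_limg_chain t : (t <= k)%N -> limg (chain N T t) = J (k - t).
Proof.
elim: t => [|t IH] t_le; first by rewrite subn0.
rewrite limg_comp IH ?(ltnW t_le) // -[RHS](orbit_onto orb); last lia.
by congr (_ @: J _)%VS; lia.
Qed.

Lemma orbit_chain_end x : chain N T k.+1 x = 0.
Proof.
have J0 : J 0%N = limg (chain N T k) by rewrite orbit_limg_chain // subnn.
have : chain N T k.+1 x \in (N @: J 0%N)%VS.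
  by rewrite chainS J0 !memv_img // memvf.
by rewrite (orbit_kill orb) memv0 => /eqP.
Qed.

Lemma orbit_span_chain u : exists x : 'I_k.+1 -> 'rV[F]_n,
  u = \sum_(t < k.+1) chain N T t (x t).
Proof.
have : u \in (\sum_(p < k.+1) J p)%VS by rewrite (orbit_span orb) memvf.
case/memv_sumP=> v vJ ->; rewrite (reindex_inj rev_ord_inj) /=.
have ex (t : 'I_k.+1) : exists x, v (rev_ord t) = chain N T t x.
  have := vJ (rev_ord t) isT; rewrite /= subSS -orbit_limg_chain;
    last exact: ltn_ord t.
  by case/memv_imgP=> x _ ->; exists x.
have [x xE] := fin_all_exists ex; exists x.
by apply: eq_bigr => t _; rewrite xE.
Qed.

Lemma orbit_chain_orthogonal s x y : s != k -> Q (T x) (chain N T s y) = 0.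
Proof.
move=> sk; have [s_le|s_gt] := leqP s k; last first.
  have -> : chain N T s y = 0.
    rewrite -(subnK s_gt) addnC; elim: (s - k.+1)%N => [|i IH].
      by rewrite addn0 orbit_chain_end.
    by rewrite addnS chainS IH linear0.
  by rewrite linear0r.
apply: (orbit_orthogonal orb (p := k) (q := (k - s)%N)) => //.
- exact: leq_subr.
- by move/eqP: sk; lia.
- by rewrite -limgT memv_img // memvf.
- by rewrite -orbit_limg_chain // memv_img // memvf.
Qed.

End Basis.

Definition orthonormal_chain (T : 'Hom('rV[F]_n, V)) : Prop :=
  limg T = J k /\ forall s x y,
    Q (T x) (chain N T s y) = if s == k then (x *m y^T) 0 0 else 0.

Lemma chain_comp (T : 'Hom('rV[F]_n, V)) (f : 'Hom('rV[F]_n, 'rV[F]_n)) t x :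
  chain N (T \o f)%VF t x = chain N T t (f x).
Proof.
by elim: t => [|t IH]; rewrite ?chainS ?IH //= comp_lfunE.
Qed.

(** The Gram matrix [G] of [Q(x, N^k y)] on J^{k,k} is symmetric, as the parity of [Q] cancels the
    sign from moving [N^k] across, and invertible, as J^{k,k} pairs only with J^{0,0}. Writing
    [G = C^T C], the basis change [(C^T)^-1] makes it the identity. *)
Lemma orthonormal_chain_exists : exists T, orthonormal_chain T.
Proof.
have dimJ := orbit_dim orb (leqnn k).
pose b : n.-tuple V := tcast dimJ (vbasis (J k)).
have bE : b = vbasis (J k) :> seq V by rewrite val_tcast.
have spanb : <<b>>%VS = J k by rewrite bE; apply: span_basis (vbasisP _).
have freeb : free b by rewrite bE; apply: basis_free (vbasisP _).
pose f (x : 'rV[F]_n) : V := \sum_i x 0 i *: b`_i.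
have f_lin : linear f.
  move=> c x y; rewrite /f scaler_sumr -big_split; apply: eq_bigr => i _.
  by rewrite !mxE scalerDl scalerA.
pose fL : {linear 'rV[F]_n -> V} :=
  HB.pack f (GRing.isLinear.Build _ _ _ _ f f_lin).
pose T := linfun fL.
have TE x : T x = \sum_i x 0 i *: b`_i by rewrite lfunE.
have limgT : limg T = J k.
  rewrite -spanb; apply/vspaceP=> u; apply/memv_imgP/idP => [[x _ ->]|ub].
    rewrite TE rpred_sum // => i _; rewrite rpredZ // memv_span //.
    by rewrite mem_nth // size_tuple.
  exists (\row_i coord b i u); rewrite ?memvf // TE {1}(coord_span ub).
  by apply: eq_bigr => i _; rewrite mxE.
have injT x : T x = 0 -> x = 0.
  rewrite TE => x0; move/freeP: freeb => /(_ _ x0) x00.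
  by apply/rowP=> i; rewrite mxE x00.
pose G : 'M[F]_n := \matrix_(i,
  j) Q (T (delta_mx 0 i)) (chain N T k (delta_mx 0 j)).
have GE x y : Q (T x) (chain N T k y) = (x *m G *m y^T) 0 0.
  have Qx w : Q (T x) w = \sum_i x 0 i * Q (T (delta_mx 0 i)) w.
    rewrite {1}[x]row_sum_delta linear_sum linear_sumlz; apply: eq_bigr => i _.
    by rewrite linearZ linearZl_LR.
  have Qy u : Q u (chain N T k y) =
    \sum_j y 0 j * Q u (chain N T k (delta_mx 0 j)).
    rewrite {1}[y]row_sum_delta linear_sum linear_sumr; apply: eq_bigr => i _.
    by rewrite linearZ linearZr_LR.
  rewrite Qy mxE; apply: eq_bigr => j _; rewrite Qx !mxE mulrC.
  by congr (_ * _); apply: eq_bigr => i _; rewrite mxE.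
have symQ x y : Q (T x) (chain N T k y) = Q (T y) (chain N T k x).
  have skewk t u v : Q (iter t N u) v = (-1) ^+ t * Q u (iter t N v).
    elim: t u v => [|t IH] u v; first by rewrite mul1r.
    by rewrite iterS orbit_skew IH -iterSr exprS mulN1r mulNr.
  have chE z : chain N T k z = iter k N (T z).
    by elim: (k) => // t IH; rewrite chainS IH.
  rewrite (form_parity (orbit_form orb)) !chE skewk mulrA -exprD.
  by rewrite -signr_odd oddD addbb mul1r.
have symG : G^T = G by apply/matrixP=> i j; rewrite !mxE symQ.
have freeG : row_free G.
  apply: inj_row_free => x xG; apply: injT.
  apply: (form_nondegenerate (orbit_form orb)) => v.
  have [y ->] := orbit_span_chain limgT v; rewrite linear_sumr big1 // => t _.
  have [tk|] := eqVneq (t : nat) k; last exact: orbit_chain_orthogonal.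
  by rewrite tk GE xG mul0mx mxE.
have [C GC] := sym_factor symG (rank_leq_row G).
have uC : C \in unitmx.
  move: freeG; rewrite row_free_unit GC unitmx_mul => /andP[_ ->] //.
pose h := linfun (mulmxr (invmx C^T) : 'rV[F]_n -> 'rV[F]_n).
have limgh : limg h = fullv.
  apply/vspaceP=> x; rewrite memvf; apply/memv_imgP; exists (x *m C^T).
    exact: memvf.
  by rewrite lfunE /= mulmxK // unitmx_tr.
exists (T \o h)%VF; split; first by rewrite limg_comp limgh.
move=> s x y; rewrite chain_comp comp_lfunE; case: eqP => [->|/eqP]; last first.
  exact: orbit_chain_orthogonal.
rewrite GE !lfunE /= GC trmx_mul !mulmxA mulmxKV ?unitmx_tr //.
by rewrite trmx_inv trmxK mulmxK.
Qed.

End OrthonormalChain.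

(** * Correspondence between matrix spaces and IVIs *)

Section Transfer.
Local Open Scope ring_scope.
Variables (R : realType) (VR : vectType R) (k n : nat).
Local Notation V := (complexification VR).
Local Notation F := R[i].
Variables (Q : {biscalar V}) (J : nat -> {vspace V}) (N : 'End(V)).
Hypothesis orb : hodge_tate_orbit k n Q J N.
Hypothesis k_gt0 : (0 < k)%N.
Variable T : 'Hom('rV[F]_n, V).
Hypothesis onT : orthonormal_chain k Q J N T.

Let skew := orbit_skew orb.
Let chQ := proj2 onT.
Let chspan := orbit_span_chain orb (proj1 onT).
Let chend := orbit_chain_end orb (proj1 onT).
Let limg_chain := orbit_limg_chain orb (proj1 onT).

Local Notation sh := (shift k Q N T).
Local Notation ac := (act k Q N T).
Local Notation ch := (chain N T).

Definition ivi (b : {vspace 'M[F]_n}) : {vspace 'End(V)} :=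
  (shiftl k Q N T @: b)%VS.

Lemma iviP (b : {vspace 'M[F]_n}) X : reflect (exists2 A,
  A \in b & X = sh A) (X \in ivi b).
Proof.
apply: (iffP memv_imgP) => -[A Ab ->]; exists A => //.
  exact: (shiftlE skew chQ chspan).
by rewrite (shiftlE skew chQ chspan).
Qed.

Lemma mem_ivi (b : {vspace 'M[F]_n}) A : (sh A \in ivi b) = (A \in b).
Proof.
apply/iviP/idP => [[B Bb AB]|]; last by exists A.
have /lker0P inj := shift_inj skew chQ chspan k_gt0.
suff -> : A = B by [].
by apply: inj; rewrite !(shiftlE skew chQ chspan).
Qed.

Lemma dim_ivi b : \dim (ivi b) = \dim b.
Proof.
by apply: limg_dim_eq; rewrite (eqP (shift_inj skew chQ chspan k_gt0)) capv0.
Qed.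

Lemma shift_horizontal A : A^T = A -> horizontal k Q J (sh A).
Proof.
move=> symA; split.
- exact: (shift_lie skew chQ chspan symA).
- move=> p p_lt; apply/subvP=> _ /memv_imgP[w + ->].
  have -> : J p.+1 = limg (ch (k - p.+1)) by rewrite limg_chain; [congr J|];
    lia.
  case/memv_imgP=> x _ ->; rewrite (shift_chain skew chQ); last lia.
  have -> : J p = limg (ch (k - p.+1).+1) by rewrite limg_chain; [congr J|];
    lia.
  by rewrite memv_img // memvf.
- apply/eqP; rewrite -subv0; apply/subvP=> _ /memv_imgP[w + ->].
  have -> : J 0%N = limg (ch k) by rewrite limg_chain // subnn.
  case/memv_imgP=> x _ ->; rewrite (shift_chain skew chQ) //.
  by rewrite chend mem0v.
Qed.

Lemma is_IVI_ivi b : commsym b -> 1%:M \in b -> is_IVI k Q J N (ivi b).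
Proof.
move=> [sym com] b1; split.
- by move=> _ /iviP[A Ab ->]; apply: shift_horizontal; apply: sym.
- move=> _ _ /iviP[A Ab ->] /iviP[B Bb ->].
  by rewrite !(shift_mul skew chQ chspan chend) com.
- by apply/iviP; exists 1%:M; rewrite ?(shift1 skew chQ chspan).
Qed.

(** Elements of [a] commute with [N], hence are shifts. Their matrices commute by comparison at
    level 2 of the chain when [n > 1], and trivially when [n <= 1]. *)
Lemma is_IVI_shift a : (1 < n -> 1 < k)%N -> is_IVI k Q J N a ->
  exists b, [/\ commsym b, 1%:M \in b & a = ivi b].
Proof.
move=> k_gt1 [hor com Na].
have aE X : X \in a -> exists2 A, A^T = A & X = sh A.
  move=> Xa; have [lieX XJ _] := hor X Xa.
  have [||A XA] := comm_shift skew chQ chspan (X := X) k_gt0.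
  - exact: com.
  - rewrite (proj1 onT) limg_chain // subn1 -[in J k](prednK k_gt0).
    by apply: XJ; rewrite prednK.
  exists A => //; apply: (lie_shift skew chQ k_gt0) => u v.
  by rewrite -XA lieX.
pose b := (shiftl k Q N T @^-1: a)%VS.
have bE A : (A \in b) = (sh A \in a).
  by rewrite -memv_preim (shiftlE skew chQ chspan).
exists b; split.
- have symb A : A \in b -> A^T = A.
    rewrite bE => /[dup] Aa /aE[B symB AB].
    have /lker0P inj := shift_inj skew chQ chspan k_gt0.
    suff -> : A = B by [].
    by apply: inj; rewrite !(shiftlE skew chQ chspan).
  split=> // A B; rewrite !bE => Aa Ba.
  have [n_gt1|n_le1] := ltnP 1 n.
    have := com _ _ Ba Aa; rewrite !(shift_mul skew chQ chspan chend) => AB.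
    apply/row_matrixP=> i; rewrite !rowE.
    apply: (chain_inj skew chQ (t := 2)); first exact: k_gt1.
    have := congr1 (fun f : 'End(V) => f (ch 0 (delta_mx 0 i))) AB.
    by rewrite !comp_lfunE !(act_chain skew chQ) // !chainS.
  case: (n) n_le1 A B {Aa Ba} => [|[|//]] _ A B.
    by apply/matrixP=> [[]].
  by rewrite [A]mx11_scalar [B]mx11_scalar -!scalar_mxM mulrC.
- by rewrite bE (shift1 skew chQ chspan).
- apply/vspaceP=> X; apply/idP/iviP => [Xa|[A]]; last by rewrite bE => + ->.
  by have [A _ XA] := aE X Xa; exists A; rewrite // bE -XA.
Qed.

Lemma max_dim_ivi b : (1 < n -> 1 < k)%N -> commsym b -> \dim b = maxdim n ->
  max_dim_IVI k Q J N (ivi b).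
Proof.
move=> k_gt1 symb max; split.
  by apply: is_IVI_ivi => //; apply: maximal_has1; rewrite ?max.
move=> _ /(is_IVI_shift k_gt1)[b' [symb' _ ->]].
by rewrite !dim_ivi max commsym_dim.
Qed.

(** [b0] gives an IVI attaining the bound, so one of maximal dimension cannot come from a smaller
    [b]. *)
Lemma max_dim_IVI_shift a (b0 : {vspace 'M[F]_n}) : (1 < n -> 1 < k)%N ->
    commsym b0 -> \dim b0 = maxdim n -> max_dim_IVI k Q J N a ->
  exists b, [/\ commsym b, (maxdim n <= \dim b)%N & a = ivi b].
Proof.
move=> k_gt1 symb0 max0 [/(is_IVI_shift k_gt1)[b [symb _ ->]] max].
exists b; split=> //; rewrite -dim_ivi -max0 -dim_ivi; apply: max.
by apply: is_IVI_ivi => //; apply: maximal_has1; rewrite ?max0.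
Qed.

Lemma orthconj_ivi (b b' : {vspace 'M[F]_n}) : orthconj b b' ->
  conjugate_IVI k Q J N (ivi b) (ivi b').
Proof.
case=> h hh <-; have hh' := mulmx1C hh.
have kerh : lker (ac h) == 0%VS.
  apply/lker0P/(can_inj (g := ac h^T)) => u.
  by rewrite -comp_lfunE (actM skew chQ chspan) hh (act1 skew chQ chspan)
    id_lfunE.
(* [act] reverses products, so conjugation by [ac h] is [compress h^T] on matrices. *)
have conjE A : (ac h \o sh A \o (ac h)^-1)%VF = sh (h^T *m A *m h).
  suff -> : (ac h \o sh A)%VF = (sh (h^T *m A *m h) \o ac h)%VF.
    by rewrite -comp_lfunA lker0_compfV ?comp_lfun1r.
  rewrite /shift comp_lfunA (act_comm skew chQ chspan chend) -!comp_lfunA.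
  by rewrite !(actM skew chQ chspan) !mulmxA hh mul1mx.
exists (ac h); split.
- split; first exact/eqP.
  exact: (act_isometry skew chQ chspan).
- move=> p p_le; have -> : J p = limg (ch (k - p)).
    by rewrite limg_chain ?leq_subr // subKn.
  apply/vspaceP=> u; apply/memv_imgP/memv_imgP =>
    [[_ /memv_imgP[x _ ->] ->]|[x _ ->]].
    by exists (x *m h); rewrite ?memvf // (act_chain skew chQ) ?leq_subr.
  exists (ch (k - p) (x *m h^T)); first by rewrite memv_img ?memvf.
  by rewrite (act_chain skew chQ) ?leq_subr // -mulmxA hh' mulmx1.
- exact: (act_comm skew chQ chspan chend).
- move=> Y; split=> [/iviP[_ /memv_imgP[A Ab ->] ->]|[_ /iviP[A Ab ->] ->]].
    exists (sh A); first by apply/iviP; exists A.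
    by rewrite conjE compressE trmxK.
  by rewrite conjE mem_ivi -[h in _ *m h]trmxK -compressE memv_img.
Qed.

(** [h] is the matrix of [g] on J^{k,k}; the order in [h *m A' = A *m h] comes from the action on
    row vectors and matches [model_nonconj]. *)
Lemma conjugate_ivi (b b' : {vspace 'M[F]_n}) : conjugate_IVI k Q J N (ivi b)
  (ivi b') ->
  exists2 h, h \in unitmx &
    forall A, A \in b -> exists2 A', A' \in b' & h *m A' = A *m h.
Proof.
case=> g [[/eqP kerg isog] gJ gN gb].
have [h hE] : exists h, forall x, g (T x) = T (x *m h).
  pose f x := chain_coord k Q N T 0 (g (T x)).
  have fE x : g (T x) = T (f x).
    have : g (T x) \in limg T.
      by rewrite (proj1 onT) -(gJ k) // memv_img //
        -(proj1 onT) memv_img ?memvf.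
    case/memv_imgP=> y _; rewrite /f => gx.
    by rewrite {1}gx; congr (T _);
      rewrite gx -[T y]/(ch 0 y) (chain_coordK skew chQ).
  exists (\matrix_i f (delta_mx 0 i)) => x; rewrite fE; congr (T _).
  rewrite mulmx_sum_row {1}[x]row_sum_delta /f !linear_sum.
  by apply: eq_bigr => i _; rewrite !linearZ /= rowK.
exists h.
  rewrite -row_free_unit; apply: inj_row_free => x xh.
  apply: (chain_inj skew chQ (t := 0)) => //; rewrite linear0 /=.
  by move/lker0P: kerg; apply; rewrite linear0 hE xh linear0.
move=> A Ab; pose Y := (g \o sh A \o g^-1)%VF.
have /iviP[A' Ab' YA'] : Y \in ivi b'.
  by apply/gb; exists (sh A) => //; apply/iviP; exists A.
exists A' => //; apply/row_matrixP=> i; rewrite !rowE !mulmxA.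
set x := delta_mx 0 i; apply: (chain_inj skew chQ (t := 1)) => //.
rewrite -(shift_chain skew chQ) // -YA' /= -hE !comp_lfunE lker0_lfunK //.
rewrite -[T x]/(ch 0 x) (act_chain skew chQ) // -comp_lfunE gN.
by rewrite comp_lfunE hE.
Qed.

End Transfer.

(** * Dimension formula and classification *)

Theorem proposition2 (R : realType) (VR : vectType R) (k n alpha beta : nat)
    (Q : {biscalar complexification VR}%R)
    (J : nat -> {vspace complexification VR})
    (N0 : 'End(complexification VR))
    (hk : 0 < k) (hk1 : 1 < n -> 1 < k) (hn0 : 0 < n)
    (hbeta : beta \in [:: 0; 1]) (hn : n = 2 * alpha + beta)
    (orb : hodge_tate_orbit k n Q J N0) :
  (exists2 a : {vspace 'End(complexification VR)},
      max_dim_IVI k Q J N0 a &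
      \dim a = if n == 1 then 1 else (alpha * (alpha + 1)) %/ 2 + beta + 1) /\
  (5 < n -> ~~ odd n ->
    forall a a' : {vspace 'End(complexification VR)},
      max_dim_IVI k Q J N0 a -> max_dim_IVI k Q J N0 a' ->
      conjugate_IVI k Q J N0 a a') /\
  (5 < n -> odd n ->
    exists a1 a2 : {vspace 'End(complexification VR)},
      [/\ max_dim_IVI k Q J N0 a1, max_dim_IVI k Q J N0 a2,
          ~ conjugate_IVI k Q J N0 a1 a2 &
          forall a : {vspace 'End(complexification VR)},
            max_dim_IVI k Q J N0 a ->
            conjugate_IVI k Q J N0 a1 a \/ conjugate_IVI k Q J N0 a2 a]).
Proof.
have [T onT] := orthonormal_chain_exists orb.
have [b0 symb0 max0] := commsym_maxdim_exists R[i] hn0.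
have {}hn : n = alpha + alpha + beta by rewrite hn; lia.
have beta_le1 : beta <= 1 by move: hbeta; rewrite !inE; lia.
split; [|split].
- exists (ivi k Q N0 T b0); first exact: max_dim_ivi.
  rewrite (dim_ivi orb hk onT) max0; case: eqP => [->|n1] //.
  rewrite hn maxdimE //; last lia.
  by rewrite bin2 divn2 [alpha * _]mulnC !addn1.
- move=> n_gt5 even_n a a'.
  have beta0 : beta = 0 by lia.
  have def_n : n = alpha + alpha by lia.
  have alpha_gt2 : 2 < alpha by lia.
  move=> /(max_dim_IVI_shift orb hk onT hk1 symb0 max0)[b [symb maxb ->]].
  move=> /(max_dim_IVI_shift orb hk onT hk1 symb0 max0)[b' [symb' maxb' ->]].
  have [L [E [fLE ->]]] := extremal_model0 alpha_gt2 def_n symb maxb.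
  have [L' [E' [fLE' ->]]] := extremal_model0 alpha_gt2 def_n symb' maxb'.
  apply: (orthconj_ivi orb hk onT); exact: model_conj0 fLE fLE'.
- move=> n_gt5 odd_n.
  have def_n : n = alpha + alpha + 1 by lia.
  have alpha_gt2 : 2 < alpha by lia.
  have alpha_gt0 : 0 < alpha by lia.
  have [L [e fLe]] := frame_exists R[i] def_n.
  (* Any nonzero [y] serves, since [model_conj2] makes the resulting spaces conjugate. *)
  pose y : 'rV[R[i]]_alpha := delta_mx ord0 (Ordinal alpha_gt0).
  have y0 : (y != 0)%R.
    by apply/rV0Pn; exists (Ordinal alpha_gt0); rewrite mxE !eqxx oner_neq0.
  have [sym1 max1] := model_projection_maxdim def_n alpha_gt0 fLe.
  have [sym2 max2] := model_symprod_maxdim def_n alpha_gt0 fLe y0.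
  exists (ivi k Q N0 T (model L (e^T *m e)%R)).
  exists (ivi k Q N0 T (model L (symprod e (y *m L)%R))); split.
  + exact: max_dim_ivi.
  + exact: max_dim_ivi.
  + move=> /(conjugate_ivi orb hk onT)[h uh].
    exact: (model_nonconj alpha_gt0 fLe uh).
  + move=> a /(max_dim_IVI_shift orb hk onT hk1 symb0 max0)[b [symb maxb ->]].
    have [L' [e' [fLe' [->|[z z0 ->]]]]] :=
      extremal_model1 alpha_gt2 def_n symb maxb.
      left; apply: (orthconj_ivi orb hk onT); exact: model_conj1.
    right; apply: (orthconj_ivi orb hk onT); exact: model_conj2.
Qed.
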